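(* Let $t$ be a fixed positive integer. There exist functions $p_1(x),\dots,p_{t-1}(x),q(x)$ of a real variable $x$, each bounded in absolute value by a polynomial in $x$, with the following property. Let $d=d(n)$ be a non-negative integer-valued function of $n$ with $d=O(\log n)$, and let $\pi\in\mathfrak{S}_n$ be chosen uniformly at random. Then \[ \Pr{\mathrm{mj}(\pi)\geq d+1}=\Big(1+\sum_{i=1}^{t-1}\frac{p_i(d)}{n^{i}}\Big)e^{-2d}+O\!\left(\frac{q(d)e^{2d}}{n^t}\right). \]
   Context: $\mathfrak{S}_n$ is the set of permutations of $[n]=\{1,\dots,n\}$. The minimum jump of $\pi\in\mathfrak{S}_n$ is $\mathrm{mj}(\pi)=\min_{1\le i\le n-1}|\pi(i+1)-\pi(i)|$. *)

(* Defs.v *)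
From mathcomp Require Import all_boot all_order all_fingroup.
From Stdlib Require Import Reals.

Set Implicit Arguments.
Unset Strict Implicit.
Unset Printing Implicit Defensive.

(* Permutations of [n] are modelled as permutations of 'I_n = {0,...,n-1};
   the jumps |pi(i+1) - pi(i)| are unchanged by this shift. *)

Definition natdist (a b : nat) : nat := (a - b) + (b - a).

(* mj(pi) >= k, i.e. every jump |pi(i+1)-pi(i)|, 1 <= i <= n-1, is >= k.
   (For n <= 1 the minimum over the empty set is +infinity, so this holds.) *)
Definition mj_ge (n : nat) (k : nat) (s : 'S_n) : bool :=
  [forall i : 'I_n, forall j : 'I_n,
     (val j == (val i).+1) ==> (k <= natdist (s j) (s i))].

Definition count_mj_ge (n k : nat) : nat := #|[set s : 'S_n | mj_ge k s]|.

Definition prob_mj_ge (n k : nat) : R :=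
  Rdiv (INR (count_mj_ge n k)) (INR (factorial n)).

Definition poly_bounded (f : R -> R) : Prop :=
  exists (c : R) (m : nat), forall x : R, Rle (Rabs (f x)) (Rmult c (pow (Rplus 1 (Rabs x)) m)).

Definition big_O_log (d : nat -> nat) : Prop :=
  exists (K : R) (N : nat), forall n : nat, (N <= n)%coq_nat ->
    Rle (INR (d n)) (Rmult K (ln (INR n))).

Definition corr_sum (t : nat) (p : nat -> R -> R) (x : R) (n : nat) : R :=
  List.fold_right (fun i acc => Rplus (Rdiv (p i x) (pow (INR n) i)) acc) 0%R
    (List.seq 1 (t - 1)).

(* Main.v *)
(** Call a pair [a -> b] with [0 < |b - a| <= d] an arc. By inclusion-exclusion over the
arcs that occur as consecutive values of the permutation,
  [Pr (mj >= d+1) = sum_k (-1)^k (2d)^k/k! * (n^k (n-k)!/n!) * rho_k],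
where [rho_k], the [forest_density], is the probability that [k] independent uniform arcs (tail
in [[n]], displacement in [[-d,d]] minus [0]) form a linear forest inside [[n]]; indeed a forest
with [k] arcs is contained in exactly [(n-k)!] linear orders.

The [u]-th difference of [rho] in [k] is the mean of an alternating sum over toggling [u] of
the arcs, which vanishes as soon as one of them is in range and touches no other arc.  It is
therefore [O(poly(k,d) / n^(u/2))], so that modulo [n^-t] the function [rho_k] is the
polynomial in [k] given by Newton's formula.  For fixed [k] the number of [k]-tuples of arcs
forming a forest is a polynomial in [n] of degree at most [k] once [n] is large compared to [d],
since lengthening a gap of [2d] vertices without tails does not affect the forest property.
Hence [n^k (n-k)!/n! * rho_k = 1 + sum_i Q_i(k,d)/n^i] with [Q_i] polynomial in [k].  As
[sum_k (-x)^k/k! 'C(k,b) = (-x)^b/b! * exp (-x)], summing over [k <= sqrt n] yields the main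
term, while the errors are summed with absolute values, whence the factor [exp (2d)]. *)

Require Import Defs.
From Stdlib Require Import Reals.
From mathcomp Require all_boot all_order all_fingroup all_algebra.
From mathcomp Require zify ring lra.
From mathcomp Require boolp reals normedtype sequences exp.
From mathcomp Require Rstruct Rstruct_topology.

Module MinimumJump.
Import all_boot all_order all_fingroup all_algebra zify ring lra boolp.
Import Order.TTheory GRing.Theory Num.Theory.
Set Implicit Arguments.
Unset Strict Implicit.
Unset Printing Implicit Defensive.

(** * Linear orders extending a set of arcs *)

Section LinearForest.
Variable T : eqType.
Implicit Types (s V : seq T) (A : seq (T * T)) (e : T * T).

Definition linked s e := infix [:: e.1; e.2] s.

Definition linear_forest A := exists2 s, uniq s & all (linked s) A.

Lemma linkedP s a b :
  reflect (exists s1 s2, s = s1 ++ [:: a, b & s2]) (linked s (a, b)).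
Proof. exact: (@infixP T [:: a; b] s). Qed.

Lemma linked_mem s e : linked s e -> (e.1 \in s) && (e.2 \in s).
Proof. by move/mem_infix => mem_s; rewrite !mem_s ?inE ?eqxx ?orbT. Qed.

Lemma linked_filter (P : pred T) s e :
  linked s e -> P e.1 -> P e.2 -> linked (filter P s) e.
Proof.
case: e => a b /linkedP[s1 [s2 ->]] /= Pa Pb; apply/linkedP.
by exists (filter P s1), (filter P s2); rewrite filter_cat /= Pa Pb.
Qed.

Lemma linked_inj_r s a b c : uniq s -> linked s (a, b) -> linked s (a, c) -> b = c.
Proof.
move=> uniq_s /linkedP[s1 [s2 s_ab]] /linkedP[t1 [t2 /eqP]].
by move: uniq_s; rewrite s_ab => /uniq_eqseq_pivotl-> /andP[_] /eqP[].
Qed.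

Lemma linked_inj_l s a b c : uniq s -> linked s (a, c) -> linked s (b, c) -> a = b.
Proof.
move=> uniq_s /linkedP[s1 [s2 s_ac]] /linkedP[t1 [t2 /eqP]].
move: uniq_s; rewrite s_ac -2!(cat_rcons _ _ (c :: _)) => /uniq_eqseq_pivotl->.
by case/andP => /eqP/rcons_inj[].
Qed.

Lemma linked_irr s a b : uniq s -> linked s (a, b) -> a != b.
Proof. by move=> uniq_s /infix_uniq/(_ uniq_s) /=; rewrite inE andbT. Qed.

Lemma linear_forest_sub A A' : {subset A' <= A} -> linear_forest A -> linear_forest A'.
Proof. by move=> sA [s Us /allP As]; exists s => //; apply/allP => e /sA/As. Qed.

Lemma linked_cons z s x y :
  linked (z :: s) (x, y) = (x == z) && (ohead s == Some y) || linked s (x, y).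
Proof.
rewrite /linked infix_consl prefix_cons /=; congr (_ && _ || _).
by case: s => [|u s] //=; rewrite prefix0s andbT eq_sym.
Qed.

Lemma linked_cat_cons s1 a s2 x y : linked (s1 ++ a :: s2) (x, y) =
  linked (rcons s1 a) (x, y) || linked (a :: s2) (x, y).
Proof.
elim: s1 => [|z s1 IH]; first by rewrite /= [in RHS]linked_cons andbF.
rewrite cat_cons rcons_cons (linked_cons z) IH (linked_cons z) orbA.
by case: s1 {IH}.
Qed.

Lemma notin_linked s x y : x \notin s -> linked s (x, y) = false.
Proof. by move=> xs; apply: contraNF xs => /linked_mem/andP[]. Qed.

Lemma linked_rcons_last s a y : a \notin s -> linked (rcons s a) (a, y) = false.
Proof.
move=> a_s; apply/negP => /linkedP[s1 [s2 /eqP]].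
by rewrite -cats1 eqseq_pivotl // => /andP[_ /eqP].
Qed.

(* Effect on the other arcs of contracting (a, b): b disappears and its outgoing arc
   now leaves from a. *)
Definition contract (a b : T) e := (if e.1 == b then a else e.1, e.2).

Lemma uniq_cat_cons2 s1 s2 a b : uniq (s1 ++ [:: a, b & s2]) ->
  [/\ a \notin s1, a \notin b :: s2, b \notin s1 & b \notin s2].
Proof.
rewrite cat_uniq => /and3P[_ /hasPn s1_disj /= /and3P[na nb _]].
by split => //; apply: s1_disj; rewrite !inE eqxx ?orbT.
Qed.

Lemma rem_linked s1 s2 a b : uniq (s1 ++ [:: a, b & s2]) ->
  rem b (s1 ++ [:: a, b & s2]) = s1 ++ a :: s2.
Proof.
move=> uniq_s; have [_ a_s2 b_s1 b_s2] := uniq_cat_cons2 uniq_s.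
have b_s1a : b \notin rcons s1 a.
  by rewrite mem_rcons inE negb_or b_s1 andbT; apply: contraNneq a_s2 => ->; rewrite mem_head.
rewrite -cat_rcons rem_filter; last by rewrite cat_rcons.
rewrite filter_cat /= eqxx /= !(all_filterP _) ?cat_rcons //.
all: by rewrite all_predC has_pred1.
Qed.

Lemma linked_contract s a b e : uniq s -> linked s (a, b) -> e.1 != a ->
  linked s e = linked (rem b s) (contract a b e).
Proof.
case: e => x y /= uniq_s /linkedP[s1 [s2 s_ab]] xa; rewrite /contract /=.
move: uniq_s; rewrite s_ab => uniq_s; rewrite rem_linked //.
have [a_s1 a_s2 b_s1 b_s2] := uniq_cat_cons2 uniq_s.
rewrite !linked_cat_cons 2!linked_cons (negbTE xa) /=.
case: (eqVneq x b) => [xb|xb] /=; last by rewrite linked_cons (negbTE xa).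
rewrite xb linked_cons eqxx /= (notin_linked y b_s2) orbF.
rewrite notin_linked ?mem_rcons ?inE ?negb_or -1?xb ?xa ?xb ?b_s1 //.
rewrite linked_rcons_last // notin_linked ?orbF //.
by move: a_s2; rewrite inE => /norP[].
Qed.

Lemma contract_inj A a b : {in A, forall e, e.1 != a} ->
  {in A &, injective (contract a b)}.
Proof.
move=> nA [x y] [x' y'] /nA/= xa /nA/= x'a; rewrite /contract /= => -[].
case: (eqVneq x b) => [->|_]; case: (eqVneq x' b) => [->|_] //.
- by move=> _ ->.
- by move=> ax'; rewrite -ax' eqxx in x'a.
- by move=> x_a; rewrite x_a eqxx in xa.
- by move=> -> ->.
Qed.

Lemma linear_forest_contract a b A : linear_forest ((a, b) :: A) -> uniq ((a, b) :: A) ->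
  [/\ linear_forest (map (contract a b) A), {in A, forall e, e.1 != a},
      {in A, forall e, e.2 != b} & a != b].
Proof.
move=> [s uniq_s /= /andP[s_ab /allP sA]] /andP[abA _].
have tails : {in A, forall e, e.1 != a}.
  move=> [x y] eA; apply: contraNneq abA => /= xa.
  by have := sA _ eA; rewrite xa => /(linked_inj_r uniq_s s_ab) ->; rewrite -xa.
have heads : {in A, forall e, e.2 != b}.
  move=> [x y] eA; apply: contraNneq abA => /= yb.
  by have := sA _ eA; rewrite yb => /(linked_inj_l uniq_s s_ab) ->; rewrite -yb.
split=> //; last exact: linked_irr uniq_s s_ab.
exists (rem b s); first exact: rem_uniq.
apply/allP => _ /mapP[e eA ->].
by rewrite -linked_contract //; [exact: sA|exact: tails].
Qed.

Lemma perm_rem_linked V a b : uniq V -> a \in V -> b \in V -> a != b ->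
  perm_eq [seq rem b s | s <- permutations V & linked s (a, b)] (permutations (rem b V)).
Proof.
move=> uniq_V aV bV ab; have permV : perm_eq V (b :: rem b V) by apply: perm_to_rem.
apply: uniq_perm; last 1 first.
- move=> s; apply/mapP/idP => [[t]|].
    rewrite mem_filter !mem_permutations => /andP[t_ab tV] ->.
    have bt : b \in t by rewrite (perm_mem tV).
    by rewrite -(perm_cons b) -(permPr permV) -(permPr tV) perm_sym perm_to_rem.
  rewrite mem_permutations => sV.
  have uniq_s : uniq s by rewrite (perm_uniq sV) rem_uniq.
  have b_s : b \notin s by rewrite (perm_mem sV) mem_rem_uniqF.
  have a_s : a \in s by rewrite (perm_mem sV) mem_rem_uniq // !inE ab.
  case/splitPr: a_s sV uniq_s b_s => s1 s2 sV uniq_s b_s.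
  have perm_b : perm_eq (s1 ++ [:: a, b & s2]) (b :: (s1 ++ a :: s2)).
    by apply/seq.permP => P; rewrite /= !count_cat /=; lia.
  exists (s1 ++ [:: a, b & s2]); last by rewrite rem_linked // (perm_uniq perm_b) /= b_s.
  rewrite mem_filter mem_permutations (permPr permV) (permPl perm_b) perm_cons sV andbT.
  by apply/linkedP; exists s1, s2.
- rewrite map_inj_in_uniq ?filter_uniq ?permutations_uniq // => s t.
  rewrite !mem_filter !mem_permutations.
  move=> /andP[/linkedP[s1 [s2 ->]] sV] /andP[/linkedP[t1 [t2 ->]] tV].
  have uniq_s : uniq (s1 ++ [:: a, b & s2]) by rewrite (perm_uniq sV).
  have uniq_t : uniq (t1 ++ [:: a, b & t2]) by rewrite (perm_uniq tV).
  rewrite !rem_linked // => /eqP; rewrite uniq_eqseq_pivotl => [/andP[/eqP-> /eqP->] //|].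
  by rewrite -(rem_linked uniq_s) rem_uniq.
- exact: permutations_uniq.
Qed.

Lemma count_linked V A : uniq V -> uniq A -> linear_forest A ->
  {in A, forall e, (e.1 \in V) && (e.2 \in V)} ->
  count (fun s => all (linked s) A) (permutations V) = (size V - size A)`!.
Proof.
move sizeA: (size A) => m.
elim: m A sizeA V => [|m IH] [|[a b] A] //= sizeA V uniq_V uniq_A forest_A AV.
  by rewrite subn0 -size_permutations // -[RHS]count_predT; apply: eq_count.
have [forest_A' tails heads ab] := linear_forest_contract forest_A uniq_A.
have /andP[/= aV bV] := AV _ (mem_head _ _).
have {}AV e : e \in A -> (e.1 \in V) && (e.2 \in V).
  by move=> eA; apply: AV; rewrite inE eA orbT.
case: sizeA => sizeA; case/andP: uniq_A => _ uniq_A.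
have sizeV : size V = (size (rem b V)).+1 by rewrite (perm_size (perm_to_rem bV)).
rewrite sizeV subSS -(IH (map (contract a b) A)) ?size_map ?rem_uniq //.
- rewrite -(seq.permP (perm_rem_linked uniq_V aV bV ab)) count_map count_filter.
  apply: eq_in_count => s; rewrite mem_permutations /= => sV; rewrite andbC.
  have uniq_s : uniq s by rewrite (perm_uniq sV).
  have [s_ab|] := boolP (linked s (a, b)); rewrite ?andbF // !andbT all_map.
  by apply: eq_in_all => e eA /=; rewrite (linked_contract uniq_s s_ab) ?tails.
- rewrite map_inj_in_uniq //; exact: contract_inj.
move=> _ /mapP[e eA ->]; rewrite !(mem_rem_uniq b uniq_V) !inE /contract /=.
have /andP[e1 ->] := AV _ eA; rewrite heads //= !andbT.
by case: (eqVneq e.1 b) => [_|->]; rewrite ?ab ?aV ?e1.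
Qed.

End LinearForest.

(** * Sums over tuples *)

Local Open Scope ring_scope.

Lemma perm_consCA (T : eqType) (x y : T) s : perm_eq [:: x, y & s] [:: y, x & s].
Proof. by apply/seq.permP => P /=; rewrite addnCA. Qed.

Section TupleSum.
Variables (V : nmodType) (T : eqType).
Implicit Types (X s : seq T) (k : nat) (h : seq T -> V).

Fixpoint tuple_sum X k h : V :=
  if k is k'.+1 then \sum_(y <- X) tuple_sum X k' (fun s => h (y :: s)) else h [::].

Lemma eq_tuple_sum_in X k h h' :
  (forall s, size s = k -> {subset s <= X} -> h s = h' s) ->
  tuple_sum X k h = tuple_sum X k h'.
Proof.
elim: k h h' => [|k IH] h h' eq_h /=; first exact: eq_h.
rewrite big_seq [RHS]big_seq; apply: eq_bigr => y yX; apply: IH => s sk sX.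
apply: eq_h => /= [|z]; first by rewrite sk.
by rewrite inE => /orP[/eqP->|/sX].
Qed.

Lemma eq_tuple_sum X k h h' : h =1 h' -> tuple_sum X k h = tuple_sum X k h'.
Proof. by move=> eq_h; apply: eq_tuple_sum_in. Qed.

Lemma tuple_sum_const X k c : tuple_sum X k (fun=> c) = c *+ (size X ^ k).
Proof.
elim: k => [//|k IH] /=.
by rewrite IH big_const_seq count_predT iter_addr_0 -mulrnA expnSr.
Qed.

Lemma tuple_sum0 X k : tuple_sum X k (fun=> 0) = 0.
Proof. by rewrite tuple_sum_const mul0rn. Qed.

Lemma tuple_sum_eq0 X k h :
  (forall s, size s = k -> {subset s <= X} -> h s = 0) -> tuple_sum X k h = 0.
Proof. by move=> h0; rewrite (eq_tuple_sum_in (h' := fun=> 0)) ?tuple_sum0. Qed.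

Lemma tuple_sumD X k h h' :
  tuple_sum X k (fun s => h s + h' s) = tuple_sum X k h + tuple_sum X k h'.
Proof.
elim: k h h' => //= k IH h h'; rewrite -big_split; apply: eq_bigr => y _; exact: IH.
Qed.

Lemma tuple_sum_sum X k (I : Type) (r : seq I) (g : I -> seq T -> V) :
  tuple_sum X k (fun s => \sum_(i <- r) g i s) = \sum_(i <- r) tuple_sum X k (g i).
Proof.
elim: k g => //= k IH g.
rewrite exchange_big; apply: eq_bigr => y _; exact: IH.
Qed.

Lemma tuple_sum_cat X u k h :
  tuple_sum X (u + k) h = tuple_sum X u (fun p => tuple_sum X k (fun s => h (p ++ s))).
Proof. by elim: u h => //= u IH h; apply: eq_bigr => y _; rewrite IH. Qed.

Lemma tuple_sumS X k h :
  tuple_sum X k.+1 h = tuple_sum X k (fun s => \sum_(y <- X) h (y :: s)).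
Proof. by rewrite tuple_sum_sum. Qed.

Lemma tuple_sum_rcons X k h :
  tuple_sum X k.+1 h = \sum_(y <- X) tuple_sum X k (fun s => h (rcons s y)).
Proof.
elim: k h => [//|k IH] h; rewrite -[LHS]/(\sum_(y <- X) tuple_sum X k.+1 (h \o cons y)).
under eq_bigr do rewrite IH.
by rewrite exchange_big.
Qed.

Lemma tuple_sum_rev X k h : tuple_sum X k (fun s => h (rev s)) = tuple_sum X k h.
Proof.
elim: k h => // k IH h; rewrite tuple_sum_rcons [RHS]/=.
by apply: eq_bigr => y _; rewrite -[RHS]IH; apply: eq_tuple_sum => s; rewrite rev_rcons.
Qed.

Lemma tuple_sum_block B X k h :
  (forall s t, perm_eq s t -> h s = h t) ->
  (forall b c s, b \in B -> c \in B -> h [:: b, c & s] = 0) ->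
  tuple_sum (B ++ X) k.+1 h
  = tuple_sum X k.+1 h + (\sum_(b <- B) tuple_sum X k (fun s => h (b :: s))) *+ k.+1.
Proof.
move=> h_perm h_BB; elim: k h h_perm h_BB => [|k IH] h h_perm h_BB.
  by rewrite /= big_cat addrC.
have h_perm_cons y s t : perm_eq s t -> h (y :: s) = h (y :: t).
  by move=> st; apply: h_perm; rewrite perm_cons.
rewrite [LHS]/= big_cat /= [LHS]addrC.
have -> : \sum_(b <- B) tuple_sum (B ++ X) k.+1 (h \o cons b)
   = \sum_(b <- B) tuple_sum X k.+1 (h \o cons b).
  rewrite big_seq [RHS]big_seq; apply: eq_bigr => b bB.
  rewrite IH => [|s t|c c' s cB _]; [|exact: h_perm_cons|exact: h_BB].
  rewrite big_seq big1 ?mul0rn ?addr0 // => c cB.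
  by apply: tuple_sum_eq0 => s _ _; apply: h_BB.
have -> : \sum_(y <- X) tuple_sum (B ++ X) k.+1 (h \o cons y)
   = tuple_sum X k.+2 h + (\sum_(b <- B) tuple_sum X k.+1 (h \o cons b)) *+ k.+1.
  under [LHS]eq_bigr => y _.
    rewrite IH => [|s t|b c s bB cB]; [over|exact: h_perm_cons|].
    by rewrite /= (h_perm _ [:: b, y, c & s] (perm_consCA _ _ _)) (h_perm_cons _ _ [:: c, y & s])
      ?h_BB ?perm_consCA.
  rewrite big_split sumrMnl; congr (_ + _ *+ _); rewrite exchange_big.
  apply: eq_bigr => b _; apply: eq_bigr => y _; apply: eq_tuple_sum => s.
  exact/h_perm/perm_consCA.
by rewrite -addrA -mulrSr.
Qed.
End TupleSum.

Lemma tuple_sum_map (V : nmodType) (T T' : eqType) (g : T -> T') X k (h : seq T' -> V) :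
  tuple_sum (map g X) k h = tuple_sum X k (fun s => h (map g s)).
Proof.
by elim: k h => //= k IH h; rewrite big_map; apply: eq_bigr => y _; rewrite IH.
Qed.

Lemma tuple_sumMl (R : pzSemiRingType) (T : eqType) (X : seq T) k c (h : seq T -> R) :
  tuple_sum X k (fun s => c * h s) = c * tuple_sum X k h.
Proof.
elim: k h => //= k IH h; rewrite mulr_sumr; apply: eq_bigr => y _; exact: IH.
Qed.

Lemma tuple_sumB (V : zmodType) (T : eqType) (X : seq T) k (h h' : seq T -> V) :
  tuple_sum X k (fun s => h s - h' s) = tuple_sum X k h - tuple_sum X k h'.
Proof.
elim: k h h' => //= k IH h h'; rewrite -sumrB; apply: eq_bigr => y _; exact: IH.
Qed.

Lemma natr_count (R : pzSemiRingType) (T : Type) (P : pred T) X :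
  (count P X)%:R = \sum_(y <- X) (P y)%:R :> R.
Proof. by rewrite -sumn_count sumnE big_map natr_sum. Qed.

Lemma count_rem_pred (T : eqType) (P : pred T) X y : uniq X -> y \in X -> P y ->
  count (predI P (predC1 y)) X = (count P X).-1.
Proof.
move=> uniq_X yX Py; rewrite -!size_filter -(size_rem (x := y)) ?mem_filter ?Py //.
by rewrite rem_filter ?filter_uniq // -filter_predI; congr size; apply: eq_filter => z /=;
  rewrite andbC.
Qed.

Lemma tuple_sum_uniq_all (R : pzSemiRingType) (T : eqType) (X : seq T) k (P : pred T) :
  uniq X -> tuple_sum X k (fun x => (uniq x && all P x)%:R) = ((count P X) ^_ k)%:R :> R.
Proof.
move=> uniq_X; elim: k P => [|k IH] P /=; first by rewrite ffactn0.
rewrite ffactnS natrM natr_count mulr_suml big_seq [RHS]big_seq.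
apply: eq_bigr => y yX; case Py: (P y); last first.
  by rewrite mul0r; apply: tuple_sum_eq0 => s _ _; rewrite andbF.
rewrite mul1r -(count_rem_pred uniq_X yX Py) -IH.
apply: eq_tuple_sum => s; congr (nat_of_bool _)%:R => /=.
rewrite all_predI -[all (predC1 y) s]/(all (predC (pred1 y)) s) all_predC has_pred1.
by case: (y \in s); case: (uniq s); case: (all P s).
Qed.

Section TupleSumOrder.
Variables (R : numDomainType) (T : eqType) (X : seq T).
Implicit Types (k : nat) (h : seq T -> R).

Lemma ler_tuple_sum k h h' : (forall s, size s = k -> h s <= h' s) ->
  tuple_sum X k h <= tuple_sum X k h'.
Proof.
elim: k h h' => [|k IH] h h' le_h /=; first exact: le_h.
by apply: ler_sum => y _; apply: IH => s sk; apply: le_h; rewrite /= sk.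
Qed.

Lemma ler_norm_tuple_sum k h : `|tuple_sum X k h| <= tuple_sum X k (fun s => `|h s|).
Proof.
elim: k h => //= k IH h; apply: le_trans (ler_norm_sum _ _ _) _.
apply: ler_sum => y _; exact: IH.
Qed.

Lemma tuple_sum_bool_bounds k (P : pred (seq T)) :
  0 <= tuple_sum X k (fun s => (P s)%:R : R) <= (size X)%:R ^+ k.
Proof.
rewrite -natrX -tuple_sum_const -[0](tuple_sum0 R X k).
by apply/andP; split; apply: ler_tuple_sum => s _; rewrite ?ler0n // lern1 leq_b1.
Qed.
End TupleSumOrder.

(** * Finite differences *)

Definition fdiff (V : zmodType) (f : nat -> V) (k : nat) : V := f k.+1 - f k.

Definition fdiffn (V : zmodType) m (f : nat -> V) : nat -> V := iter m (@fdiff V) f.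

Section FiniteDifference.
Variable V : zmodType.
Implicit Types f g : nat -> V.

Lemma eq_fdiffn m f g : f =1 g -> fdiffn m f =1 fdiffn m g.
Proof. by rewrite /fdiffn => eq_fg; elim: m => //= m IH k; rewrite /fdiff !IH. Qed.

Lemma fdiffnS m f k : fdiffn m.+1 f k = fdiffn m f k.+1 - fdiffn m f k.
Proof. by []. Qed.

Lemma fdiffnSr m f : fdiffn m.+1 f = fdiffn m (fdiff f).
Proof. exact: iterSr. Qed.

Lemma fdiffnD m f g k : fdiffn m (fun k => f k + g k) k = fdiffn m f k + fdiffn m g k.
Proof. by elim: m k => // m IH k; rewrite !fdiffnS !IH opprD addrACA. Qed.

Lemma fdiffn_sum m (I : Type) (r : seq I) (g : I -> nat -> V) k :
  fdiffn m (fun k => \sum_(i <- r) g i k) k = \sum_(i <- r) fdiffn m (g i) k.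
Proof. by elim: m k => // m IH k; rewrite fdiffnS !IH -sumrB. Qed.

Lemma fdiffn_addn m f a k : fdiffn m (fun j => f (a + j)%N) k = fdiffn m f (a + k)%N.
Proof. by elim: m k => // m IH k; rewrite !fdiffnS !IH addnS. Qed.

Lemma sum_fdiff f k : f k = f 0%N + \sum_(j < k) fdiff f j.
Proof. by rewrite -(big_mkord predT) telescope_sumr // addrC subrK. Qed.

Definition degree_lt_from N m f := forall n, (N <= n)%N -> fdiffn m f n = 0.

Lemma degree_lt_fromW N N' m m' f : (N <= N')%N -> (m <= m')%N ->
  degree_lt_from N m f -> degree_lt_from N' m' f.
Proof.
move=> NN' /subnKC <- deg_f; elim: (m' - m)%N => [|i IH] n Nn.
  by rewrite addn0 deg_f // (leq_trans NN').
by rewrite addnS fdiffnS !IH ?subrr // leqW.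
Qed.

Lemma degree_lt_fromD N m f g : degree_lt_from N m f -> degree_lt_from N m g ->
  degree_lt_from N m (fun n => f n + g n).
Proof. by move=> deg_f deg_g n Nn; rewrite fdiffnD deg_f ?deg_g ?addr0. Qed.

Lemma degree_lt_from_sum N m (I : eqType) (r : seq I) (g : I -> nat -> V) :
  {in r, forall i, degree_lt_from N m (g i)} ->
  degree_lt_from N m (fun n => \sum_(i <- r) g i n).
Proof.
move=> deg_g n Nn; rewrite fdiffn_sum big_seq big1 // => i ir; exact: deg_g.
Qed.

Lemma degree_lt_from_fdiff N m f :
  degree_lt_from N m (fdiff f) -> degree_lt_from N m.+1 f.
Proof. by move=> deg_f n Nn; rewrite fdiffnSr deg_f. Qed.

Lemma degree_lt_from_succ N m f :
  degree_lt_from N m (fun n => f n.+1) -> degree_lt_from N.+1 m f.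
Proof. by move=> deg_f [|n] // Nn; rewrite -(deg_f n Nn) -(fdiffn_addn m f 1). Qed.

End FiniteDifference.

Lemma fdiffnMl (R : pzRingType) m c (f : nat -> R) k :
  fdiffn m (fun k => c * f k) k = c * fdiffn m f k.
Proof. by elim: m k => // m IH k; rewrite !fdiffnS !IH mulrBr. Qed.

Lemma degree_lt_fromMl (R : pzRingType) N m c (f : nat -> R) :
  degree_lt_from N m f -> degree_lt_from N m (fun n => c * f n).
Proof. by move=> deg_f n Nn; rewrite fdiffnMl deg_f ?mulr0. Qed.

Lemma sum_bin k b : (\sum_(j < k) 'C(j, b) = 'C(k, b.+1))%N.
Proof.
elim: k => [|k IH]; first by rewrite big_ord0 bin0n.
by rewrite big_ord_recr /= IH binS addnC.
Qed.

Section Newton.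
Variable R : numDomainType.
Implicit Types f : nat -> R.

Lemma newton_remainder m f k (eps : R) :
  (forall j, (j <= k)%N -> `|fdiffn m f j| <= eps) ->
  `|f k - \sum_(b < m) 'C(k, b)%:R * fdiffn b f 0%N| <= 'C(k, m)%:R * eps.
Proof.
elim: m f k => [|m IH] f k diff_le; first by rewrite big_ord0 subr0 bin0 mul1r; exact: diff_le.
have -> : \sum_(b < m.+1) 'C(k, b)%:R * fdiffn b f 0%N =
   f 0%N + \sum_(j < k) \sum_(b < m) 'C(j, b)%:R * fdiffn b (fdiff f) 0%N.
  rewrite big_ord_recl bin0 mul1r exchange_big; congr (_ + _); apply: eq_bigr => b _.
  by rewrite lift0 fdiffnSr -sum_bin natr_sum mulr_suml.
rewrite (sum_fdiff f k) opprD addrACA subrr add0r -sumrB -sum_bin natr_sum mulr_suml.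
apply: le_trans (ler_norm_sum _ _ _) _; apply: ler_sum => j _.
by apply: IH => i ij; rewrite -fdiffnSr; apply: diff_le; have := ltn_ord j; lia.
Qed.

Lemma newton_exact N m f k : degree_lt_from N m f -> (N <= k)%N ->
  f k = \sum_(b < m) 'C(k - N, b)%:R * fdiffn b f N.
Proof.
move=> deg_f Nk; apply/eqP; rewrite -subr_eq0 -normr_le0.
have := @newton_remainder m (fun j => f (N + j)%N) (k - N) 0; rewrite mulr0 subnKC //.
under eq_bigr do rewrite fdiffn_addn addn0.
by apply=> j _; rewrite fdiffn_addn deg_f ?leq_addr ?normr0.
Qed.

Lemma ler_norm_fdiffn m f k (c : R) : (forall j, (j <= k + m)%N -> `|f j| <= c) ->
  `|fdiffn m f k| <= 2 ^+ m * c.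
Proof.
elim: m k => [|m IH] k f_le; first by rewrite mul1r; apply: f_le; lia.
rewrite fdiffnS; apply: le_trans (ler_normB _ _) _.
rewrite exprS -mulrA mulr2n mulrDl mul1r; apply: lerD; apply: IH => j jk; apply: f_le; lia.
Qed.
End Newton.

(** * Toggling elements of a random tuple *)

Section Toggle.
Variables (V : zmodType) (T : eqType).
Implicit Types (f : seq T -> V) (s p l x : seq T).

Fixpoint toggle p f s : V :=
  if p is y :: p' then toggle p' (fun s => f (y :: s) - f s) s else f s.

Variables (forbidden : pred T) (meets : rel T).

Definition insensitive l f := (forall s t, perm_eq s t -> f s = f t) /\
  forall y x, ~~ forbidden y -> ~~ has (meets y) l -> ~~ has (meets y) x -> f (y :: x) = f x.

Lemma insensitive_diff l f y : insensitive l f ->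
  insensitive (y :: l) (fun s => f (y :: s) - f s).
Proof.
move=> [f_perm f_add]; split=> [s t st|z x z_ok].
  by rewrite (f_perm _ _ st) (f_perm (y :: s) (y :: t)) ?perm_cons.
rewrite /= negb_or => /andP[zy zl] zx; rewrite (f_add z x) //; congr (_ - _).
by rewrite (f_perm _ _ (perm_consCA _ _ _)) f_add //= negb_or zy.
Qed.

Lemma toggle_eq0 y p f s :
  (forall x, ~~ has (meets y) x -> f x = 0) -> ~~ has (meets y) (p ++ s) ->
  toggle p f s = 0.
Proof.
elim: p f => [|z p IH] f f0 /=; first exact: f0.
rewrite negb_or => /andP[yz yp]; apply: IH => // x yx.
by rewrite !f0 ?subrr //= negb_or yz.
Qed.

Fixpoint crowded l p s : bool :=
  if p is y :: p' then [|| forbidden y, has (meets y) l | has (meets y) (p' ++ s)]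
                       && crowded (y :: l) p' s else true.

Lemma toggle_sparse l p f s : insensitive l f -> ~~ crowded l p s -> toggle p f s = 0.
Proof.
elim: p l f => [//|y p IH] l f f_ins /=; rewrite negb_and => /orP[|p_sparse]; last first.
  by apply: IH p_sparse; apply: insensitive_diff.
rewrite !negb_or => /and3P[y_ok yl yps]; apply: toggle_eq0 yps => x yx.
by rewrite f_ins.2 ?subrr.
Qed.

Fixpoint conflicts x : nat :=
  if x is y :: x' then ((forbidden y || has (meets y) x') + conflicts x')%N else 0%N.

Fixpoint conflicts_acc l x : nat :=
  if x is y :: x' then ((forbidden y || has (meets y) l) + conflicts_acc (y :: l) x')%N
  else 0%N.

Lemma conflicts_catrev x l : conflicts (catrev x l) = (conflicts_acc l x + conflicts l)%N.
Proof. by elim: x l => [|y x IH] l //=; rewrite IH /= addnCA addnA. Qed.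

(* [conflicts] compares each element with the ones to its right and [conflicts_acc] with the
   ones to its left, so a crowded element is counted at least once. *)
Lemma crowded_le_conflicts l p s : crowded l p s ->
  (size p <= conflicts (p ++ s) + conflicts_acc l (p ++ s))%N.
Proof.
elim: p l => [//|y p IH] l /= /andP[y_conflict /IH].
by move: y_conflict; case: (forbidden y) => /=; [|case/orP => ->]; rewrite ?orbT; lia.
Qed.

Lemma crowded_half p s : crowded [::] p s ->
  (uphalf (size p) <= conflicts (p ++ s))%N || (uphalf (size p) <= conflicts (rev (p ++ s)))%N.
Proof.
move=> /crowded_le_conflicts; rewrite /rev conflicts_catrev addn0.
by case: leqP => //= ? ?; lia.
Qed.
End Toggle.

Lemma ler_norm_toggle (R : numDomainType) (T : eqType) p (f : seq T -> R) s c :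
  (forall x, `|f x| <= c) -> `|toggle p f s| <= 2 ^+ size p * c.
Proof.
elim: p f c => [|y p IH] f c f_le /=; first by rewrite mul1r.
rewrite exprSr -mulrA; apply: IH => x; apply: le_trans (ler_normB _ _) _.
by rewrite mulr2n mulrDl mul1r; apply: lerD.
Qed.

Section TupleMean.
Variables (R : numFieldType) (T : eqType) (forbidden : pred T) (meets : rel T).
Implicit Types (f : seq T -> R) (s p x X : seq T).

Local Notation conflicts := (conflicts forbidden meets).

Lemma toggle_le_conflicts p f s : insensitive forbidden meets [::] f ->
  (forall x, `|f x| <= 1) ->
  `|toggle p f s| <= 2 ^+ size p *
    ((uphalf (size p) <= conflicts (p ++ s))%N%:R
      + (uphalf (size p) <= conflicts (rev (p ++ s)))%N%:R).
Proof.
move=> f_ins f_le1; have [|p_sparse] := boolP (crowded forbidden meets [::] p s); last first.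
  by rewrite (toggle_sparse f_ins p_sparse) normr0 mulr_ge0 ?exprn_ge0 ?addr_ge0.
move=> /crowded_half half; apply: le_trans (ler_norm_toggle _ _ f_le1) _.
rewrite ler_pM2l ?exprn_gt0 // -natrD ler1n.
by case/orP: half => ->; rewrite // addn1.
Qed.

Definition tuple_mean X k f : R := tuple_sum X k f / (size X)%:R ^+ k.

Lemma fdiff_tuple_mean X f k : X != [::] -> fdiff (fun k => tuple_mean X k f) k
  = (size X)%:R^-1 * \sum_(y <- X) tuple_mean X k (fun s => f (y :: s) - f s).
Proof.
rewrite -size_eq0 => X0; have N0 : (size X)%:R != 0 :> R by rewrite pnatr_eq0.
rewrite /fdiff /tuple_mean -mulr_suml /=.
under [in RHS]eq_bigr do rewrite tuple_sumB.
rewrite sumrB big_const_seq count_predT iter_addr_0 -[tuple_sum X k f *+ _]mulr_natr exprS.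
by field; rewrite expf_neq0.
Qed.

Lemma fdiffn_tuple_mean X f k u : X != [::] -> fdiffn u (fun k => tuple_mean X k f) k
  = tuple_sum X u (fun p => tuple_sum X k (toggle p f)) / (size X)%:R ^+ (u + k).
Proof.
move=> X0; elim: u f => [//|u IH] f; rewrite fdiffnSr.
rewrite (eq_fdiffn _ (fun k => fdiff_tuple_mean f k X0)) fdiffnMl fdiffn_sum.
rewrite (eq_bigr _ (fun y _ => IH (fun s => f (y :: s) - f s))).
by rewrite -mulr_suml addSn exprS invfM mulrCA.
Qed.

Variables (X : seq T) (delta : R).
Hypothesis delta_ge0 : 0 <= delta.
Hypothesis forbidden_rare : (count forbidden X)%:R <= delta * (size X)%:R.
Hypothesis meets_rare : forall e, (count (meets^~ e) X)%:R <= delta * (size X)%:R.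

Lemma conflicting_rare x :
  (count (fun y => forbidden y || has (meets y) x) X)%:R
  <= (size x).+1%:R * delta * (size X)%:R.
Proof.
elim: x => [|e x IH] /=.
  by rewrite mul1r (eq_count (a2 := forbidden)) // => y; rewrite orbF.
rewrite mulrSr 2!mulrDl mul1r; apply: le_trans (lerD IH (meets_rare e)).
rewrite -natrD ler_nat -count_predUI; apply: leq_trans (leq_addr _ _).
by apply: sub_count => y /=; case: (forbidden y); case: (meets y e); case: (has _ _).
Qed.

Lemma tuple_sum_conflictsS k t :
  tuple_sum X k.+1 (fun x => (t < conflicts x)%N%:R) <= (size X)%:R *
    (tuple_sum X k (fun x => (t < conflicts x)%N%:R)
     + k.+1%:R * delta * tuple_sum X k (fun x => (t <= conflicts x)%N%:R)).
Proof.
rewrite mulrDr mulrCA mulrA -!tuple_sumMl -tuple_sumD tuple_sumS.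
apply: ler_tuple_sum => s sk.
apply: (@le_trans _ _ (\sum_(y <- X) ((t < conflicts s)%N%:R +
    (forbidden y || has (meets y) s)%:R * (t <= conflicts s)%N%:R))).
  apply: ler_sum => y _ /=; case: (forbidden y || _).
    by rewrite add1n mul1r ltnS lerDr.
  by rewrite add0n mul0r addr0.
rewrite big_split /= big_const_seq count_predT iter_addr_0 -mulr_suml -natr_count.
by rewrite -[_ *+ size X]mulr_natl lerD // ler_wpM2r // -sk conflicting_rare.
Qed.

Lemma tuple_sum_conflicts k t : tuple_sum X k (fun x => (t <= conflicts x)%N%:R)
  <= (k%:R ^+ 2 * delta) ^+ t * (size X)%:R ^+ k.
Proof.
have sq_ge0 n : 0 <= n%:R ^+ 2 * delta by rewrite mulr_ge0 ?exprn_ge0.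
elim: k t => [|k IH] [|t] /=; rewrite ?expr0 ?mul1r ?mulr1 ?exprn_ge0 //.
  by have /andP[] := tuple_sum_bool_bounds R X k.+1 xpredT.
apply: le_trans (tuple_sum_conflictsS k t) _.
rewrite [_ ^+ k.+1]exprS [leRHS]mulrCA ler_wpM2l //.
apply: le_trans (lerD (IH t.+1) (ler_wpM2l _ (IH t))) _; first by rewrite mulr_ge0.
rewrite mulrA -mulrDl ler_wpM2r ?exprn_ge0 // exprS -mulrDl [leRHS]exprS.
apply: ler_pM; rewrite ?exprn_ge0 ?addr_ge0 ?mulr_ge0 //.
  by rewrite -mulrDl ler_wpM2r // -!natrX -natrD ler_nat; nia.
by apply: lerXn2r; rewrite ?nnegrE // ler_wpM2r // lerXn2r ?nnegrE ?ler_nat.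
Qed.

Lemma ler_norm_fdiffn_tuple_mean f k u : X != [::] -> insensitive forbidden meets [::] f ->
  (forall x, `|f x| <= 1) ->
  `|fdiffn u (fun k => tuple_mean X k f) k|
  <= 2 ^+ u.+1 * ((u + k)%:R ^+ 2 * delta) ^+ uphalf u.
Proof.
move=> X0 f_ins f_le1; rewrite fdiffn_tuple_mean //.
have N0 : 0 < (size X)%:R ^+ (u + k) :> R by rewrite exprn_gt0 // ltr0n lt0n size_eq0.
rewrite normrM normfV (ger0_norm (ltW N0)) ler_pdivrMr //.
apply: le_trans (ler_norm_tuple_sum _ _ _) _.
pose many x : R := (uphalf u <= conflicts x)%N%:R.
apply: (@le_trans _ _ (tuple_sum X (u + k) (fun x => 2 ^+ u * (many x + many (rev x))))).
  rewrite tuple_sum_cat; apply: ler_tuple_sum => p pu.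
  apply: le_trans (ler_norm_tuple_sum _ _ _) _; apply: ler_tuple_sum => s _.
  by rewrite /many -pu; apply: toggle_le_conflicts.
rewrite tuple_sumMl tuple_sumD (tuple_sum_rev _ _ many) exprSr -mulrA -[leRHS]mulrA.
rewrite ler_wpM2l ?exprn_ge0 //.
by rewrite [leRHS]mulr_natl mulr2n; apply: lerD; apply: tuple_sum_conflicts.
Qed.
End TupleMean.

(** * Inclusion-exclusion over linear forests *)

Section ForestIn.
Variable T : eqType.
Implicit Types (s V : seq T) (x A X : seq (T * T)) (e y : T * T).

Definition forest_in V x :=
  [&& uniq x, all (fun e => (e.1 \in V) && (e.2 \in V)) x & `[< linear_forest x >]].

Definition unusable V y := ~~ [&& y.1 \in V, y.2 \in V & y.1 != y.2].

Definition incident y e := (y.1 \in [:: e.1; e.2]) || (y.2 \in [:: e.1; e.2]).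

Lemma perm_forest_in V x x' : perm_eq x x' -> forest_in V x = forest_in V x'.
Proof.
move=> xx'; rewrite /forest_in (perm_uniq xx') (perm_all _ xx'); congr [&& _, _ & _].
by apply/asboolP/asboolP; apply: linear_forest_sub => e; rewrite (perm_mem xx').
Qed.

Lemma linear_forest_cons y x : y.1 != y.2 -> ~~ has (incident y) x ->
  linear_forest x -> linear_forest (y :: x).
Proof.
case: y => a b /= ab /hasPn x_apart [s uniq_s /allP s_x].
pose other z := (z != a) && (z != b).
exists ([seq z <- s | other z] ++ [:: a; b]).
  by rewrite cat_uniq filter_uniq //= !mem_filter /other !eqxx andbF inE ab.
rewrite /=; apply/andP; split; first exact/infix_catl/infix_refl.
apply/allP => e ex; apply: infix_catr; have := x_apart e ex.
rewrite /incident /= !inE !negb_or => /andP[/andP[a1 a2] /andP[b1 b2]].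
by apply: linked_filter; rewrite ?s_x /other //= eq_sym ?a1 ?a2 eq_sym ?b1 ?b2.
Qed.

Lemma forest_in_cons V y x : ~~ unusable V y -> ~~ has (incident y) x ->
  forest_in V (y :: x) = forest_in V x.
Proof.
rewrite negbK => /and3P[y1 y2 y_loopless] x_apart; rewrite /forest_in /= y1 y2 /=.
have -> /= : y \notin x.
  by apply: contra x_apart => yx; apply/hasP; exists y; rewrite // /incident inE eqxx.
congr [&& _, _ & _]; apply/asboolP/asboolP; last exact: linear_forest_cons.
by apply: linear_forest_sub => e ex; rewrite inE ex orbT.
Qed.

Lemma insensitive_forest_in (R : pzRingType) V :
  insensitive (unusable V) incident [::] (fun x => (forest_in V x)%:R : R).
Proof.
by split=> [s t st|y x y_ok _ yx]; [rewrite (perm_forest_in V st)|rewrite forest_in_cons].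
Qed.

Lemma forest_in_nil V : forest_in V [::].
Proof. by rewrite /forest_in /=; apply/asboolP; exists [::]. Qed.

Lemma count_linked_forest_in V x : uniq V ->
  count (fun s => uniq x && all (linked s) x) (permutations V)
  = ((size V - size x)`! * forest_in V x)%N.
Proof.
move=> uniq_V; have [uniq_x|x_dup] /= := boolP (uniq x); last first.
  by rewrite /forest_in (negbTE x_dup) muln0; elim: (permutations V).
have [/and3P[_ /allP xV /asboolP x_forest]|not_forest] := boolP (forest_in V x).
  by rewrite muln1 count_linked.
rewrite muln0; apply/eqP; rewrite -leqn0 leqNgt -has_count.
apply: contra not_forest => /hasP[s]; rewrite mem_permutations => sV /allP s_x.
rewrite /forest_in uniq_x /=; apply/andP; split.
  by apply/allP => e /s_x/linked_mem; rewrite !(perm_mem sV).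
by apply/asboolP; exists s; [rewrite (perm_uniq sV)|apply/allP].
Qed.

Lemma count_linked_le X s : uniq X -> uniq s -> (count (linked s) X <= size s)%N.
Proof.
move=> uniq_X uniq_s; rewrite -size_filter -(size_map fst); apply: uniq_leq_size.
  rewrite map_inj_in_uniq ?filter_uniq // => -[a b] [a' b'].
  rewrite !mem_filter /= => /andP[s_ab _] /andP[s_ab' _] aa; move: s_ab'; rewrite -aa => s_ab'.
  by rewrite (linked_inj_r uniq_s s_ab s_ab').
by move=> a /mapP[e]; rewrite mem_filter => /andP[/linked_mem/andP[? _] _] ->.
Qed.
End ForestIn.

Lemma sum_bin_alternating (R : pzRingType) m n : (m <= n)%N ->
  \sum_(k < n.+1) (-1) ^+ k * 'C(m, k)%:R = (m == 0%N)%:R :> R.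
Proof.
move=> mn; have -> : (m == 0%N)%:R = (1 - 1 : R) ^+ m by rewrite subrr expr0n.
rewrite addrC exprD1n (big_ord_widen n.+1 (fun i => (-1) ^+ i *+ 'C(m, i))) //.
rewrite [RHS]big_mkcond; apply: eq_bigr => k _; rewrite mulr_natr.
by case: ltnP => // mk; rewrite bin_small.
Qed.

Lemma count_avoiding (R : numFieldType) (T : eqType) (V : seq T) (X : seq (T * T)) :
  uniq V -> uniq X ->
  (count (fun s => ~~ has (linked s) X) (permutations V))%:R
  = \sum_(k < (size V).+1) (-1) ^+ k * (size V - k)`!%:R / k`!%:R
      * tuple_sum X k (fun x => (forest_in V x)%:R) :> R.
Proof.
move=> uniq_V uniq_X; rewrite natr_count.
have avoids s : s \in permutations V -> (~~ has (linked s) X)%:R =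
  \sum_(k < (size V).+1) ((-1) ^+ k / k`!%:R
     * tuple_sum X k (fun x => (uniq x && all (linked s) x)%:R)) :> R.
  rewrite mem_permutations => sV; rewrite has_count -eqn0Ngt.
  rewrite -(@sum_bin_alternating _ _ (size V)); last first.
    by rewrite -(perm_size sV) count_linked_le // (perm_uniq sV).
  apply: eq_bigr => k _; rewrite tuple_sum_uniq_all // -bin_ffact natrM -mulrA; congr (_ * _).
  by rewrite mulrCA mulVf ?mulr1 // pnatr_eq0 -lt0n fact_gt0.
rewrite big_seq (eq_bigr _ avoids) -big_seq exchange_big /=; apply: eq_bigr => k _.
rewrite -mulr_sumr -tuple_sum_sum.
rewrite (eq_tuple_sum_in (h' := fun x => (size V - k)`!%:R * (forest_in V x)%:R)).
  by rewrite tuple_sumMl; ring.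
by move=> x <- _; rewrite -natr_count count_linked_forest_in // natrM.
Qed.

Lemma linear_forest_map (T T' : eqType) (f : T -> T') (g : T' -> T) (A : seq (T * T)) :
  cancel f g -> linear_forest [seq (f e.1, f e.2) | e <- A] <-> linear_forest A.
Proof.
move=> fK; split=> -[s uniq_s /allP s_A].
  exists (map g [seq z <- s | f (g z) == z]).
    rewrite map_inj_in_uniq ?filter_uniq // => z z'; rewrite !mem_filter /=.
    by move=> /andP[/eqP <- _] /andP[/eqP <- _]; rewrite !fK => ->.
  apply/allP => -[a b] eA; have := s_A _ (map_f _ eA).
  move=> /(linked_filter (P := fun z => f (g z) == z)); rewrite /= !fK !eqxx.
  move=> /(_ isT isT)/linkedP[s1 [s2 ->]].
  by apply/linkedP; exists (map g s1), (map g s2); rewrite map_cat /= !fK.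
exists (map f s); first by rewrite map_inj_uniq //; apply: can_inj fK.
apply/allP => _ /mapP[[a b] eA ->]; have /linkedP[s1 [s2 ->]] := s_A _ eA.
by apply/linkedP; exists (map f s1), (map f s2); rewrite map_cat.
Qed.

(** * Arcs of bounded displacement *)

(* Vertices are shifted by d, so that the head a + c - d of an arc leaving a
   remains a natural number even when it falls outside of {0, ..., n-1}. *)
Definition arcs_at d a : seq (nat * nat) :=
  [seq (a + d, a + c)%N | c <- rem d (iota 0 (d.*2.+1))].

Definition arcs d p n : seq (nat * nat) := flatten [seq arcs_at d a | a <- iota p n].

Lemma mem_arcs_at d a e :
  (e \in arcs_at d a) = [&& e.1 == a + d, a <= e.2, e.2 <= a + d.*2 & e.2 != e.1]%N.
Proof.
case: e => u v /=; apply/mapP/and4P => [[c]|[/eqP -> av va vu]].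
  rewrite (mem_rem_uniq d (iota_uniq _ _)) !inE mem_iota => /andP[cd c2] [-> ->].
  by split; apply/eqP || idtac; lia.
exists (v - a)%N; last by congr (_, _); lia.
rewrite (mem_rem_uniq d (iota_uniq _ _)) !inE mem_iota; lia.
Qed.

Lemma size_arcs_at d a : size (arcs_at d a) = d.*2.
Proof. by rewrite size_map size_rem ?size_iota // mem_iota; lia. Qed.

Lemma arcs_at_uniq d a : uniq (arcs_at d a).
Proof.
rewrite map_inj_uniq ?rem_uniq ?iota_uniq // => c c' [] /eqP.
by rewrite eqn_add2l => /eqP.
Qed.

Lemma mem_arcs d p n e : (e \in arcs d p n) =
  [&& p + d <= e.1, e.1 < p + n + d, e.1 <= e.2 + d, e.2 <= e.1 + d & e.2 != e.1]%N.
Proof.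
apply/flatten_mapP/and5P => [[a]|[ge_p lt_pn ge_d le_d loopless]].
  by rewrite mem_iota mem_arcs_at => ? /and4P[/eqP ? ? ? ?]; split=> //; lia.
exists (e.1 - d)%N; first by rewrite mem_iota; lia.
by rewrite mem_arcs_at loopless andbT; apply/and3P; split; apply/eqP || idtac; lia.
Qed.

Lemma arcsS d p n : arcs d p n.+1 = arcs_at d p ++ arcs d p.+1 n.
Proof. by []. Qed.

Lemma size_arcs d p n : size (arcs d p n) = (d.*2 * n)%N.
Proof.
elim: n p => [|n IH] p; first by rewrite muln0.
by rewrite arcsS size_cat size_arcs_at IH mulnS.
Qed.

Lemma arcs_uniq d p n : uniq (arcs d p n).
Proof.
elim: n p => [//|n IH] p; rewrite arcsS cat_uniq arcs_at_uniq IH andbT /=.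
apply/hasPn => e; rewrite mem_arcs mem_arcs_at => /and5P[? _ _ _ _].
by apply/negP => /and4P[/eqP ? _ _ _]; lia.
Qed.

Lemma arcs_shift d p n : arcs d p.+1 n = [seq (e.1.+1, e.2.+1) | e <- arcs d p n].
Proof.
elim: n p => [//|n IH] p; rewrite !arcsS map_cat IH; congr (_ ++ _).
by rewrite /arcs_at -map_comp; apply: eq_map => c.
Qed.

Lemma count_arcs_tail d n v : (count (fun y => y.1 == v) (arcs d 0 n) <= d.*2)%N.
Proof.
rewrite -size_filter -(size_arcs_at d (v - d)); apply: uniq_leq_size.
  by rewrite filter_uniq ?arcs_uniq.
move=> [a b]; rewrite mem_filter mem_arcs mem_arcs_at /=.
by case/andP => /eqP-> /and5P[? ? ? ? ->]; rewrite andbT; apply/and3P; split; lia.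
Qed.

Lemma count_arcs_head d n v : (count (fun y => y.2 == v) (arcs d 0 n) <= d.*2)%N.
Proof.
pose nearby := rem v (iota (v - d) d.*2.+1).
have -> : d.*2 = size [seq (w, v) | w <- nearby].
  by rewrite size_map size_rem ?size_iota // mem_iota; lia.
rewrite -size_filter; apply: uniq_leq_size; first by rewrite filter_uniq ?arcs_uniq.
move=> [a b]; rewrite mem_filter mem_arcs => /andP[/eqP/= -> /and5P[? ? ? ? va]].
apply/mapP; exists a => //.
by rewrite /nearby mem_rem_uniq ?iota_uniq // !inE eq_sym va mem_iota /=; lia.
Qed.

Lemma count_predU_le (T : Type) (P Q : pred T) X :
  (count (fun y => P y || Q y) X <= count P X + count Q X)%N.
Proof. by rewrite -count_predUI leq_addr. Qed.

Lemma count_arcs_head_in d n (L : seq nat) :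
  (count (fun y => y.2 \in L) (arcs d 0 n) <= size L * d.*2)%N.
Proof.
elim: L => [|v L IH]; first by rewrite (eq_count (a2 := pred0)) ?count_pred0.
rewrite mulSn; apply: leq_trans (leq_add (count_arcs_head d n v) IH).
exact: leq_trans (count_predU_le _ _ _).
Qed.

Lemma count_unusable_arcs d n : (count (unusable (iota d n)) (arcs d 0 n) <= d.*2 * d.*2)%N.
Proof.
pose margin := iota 0 d ++ iota (n + d) d.
have {1}-> : d.*2 = size margin by rewrite size_cat !size_iota addnn.
apply: leq_trans (count_arcs_head_in d n margin).
rewrite -!size_filter; apply: uniq_leq_size; first by rewrite filter_uniq ?arcs_uniq.
move=> e; rewrite !mem_filter /margin mem_cat /unusable !mem_iota mem_arcs /=.
by case/andP => unusable_e /and5P[? ? ? ? ne]; move: unusable_e; rewrite eq_sym ne; lia.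
Qed.

Lemma count_incident_arcs d n (e : nat * nat) :
  (count (fun y : nat * nat => incident y e) (arcs d 0 n) <= 4 * d.*2)%N.
Proof.
rewrite (eq_count (a2 := fun y => (y.1 == e.1) || ((y.1 == e.2)
  || ((y.2 == e.1) || (y.2 == e.2))))); last by move=> y; rewrite /incident !inE !orbA.
rewrite !mulSn addn0.
do 3 (apply: leq_trans (count_predU_le _ _ _) _; apply: leq_add;
  first by rewrite ?count_arcs_tail ?count_arcs_head).
exact: count_arcs_head.
Qed.

(** * Polynomiality of the number of forests *)

Section ForestCount.
Variables (R : pzRingType) (d : nat).

Definition extensions pre v p n : R :=
  tuple_sum (arcs d p n) v (fun x => (forest_in (iota d (p + n)) (pre ++ x))%:R).

Definition increment pre v p n : R :=
  if v is v'.+1 then (\sum_(e <- arcs_at d p) extensions (e :: pre) v' p.+1 n) *+ v else 0.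

Lemma extensionsS pre v p n :
  extensions pre v p n.+1 = extensions pre v p.+1 n + increment pre v p n.
Proof.
case: v => [|v]; first by rewrite /increment addr0 /extensions addSnnS.
rewrite /increment /extensions arcsS tuple_sum_block => [|s t st|b c s bB cB].
- rewrite addSnnS; congr (_ + _ *+ _); apply: eq_bigr => e _; apply: eq_tuple_sum => s.
  by congr (nat_of_bool _)%:R; apply: perm_forest_in; rewrite -cat1s perm_catCA.
- by rewrite (@perm_forest_in _ _ _ (pre ++ t)) // perm_cat2l.
rewrite /forest_in; case: asboolP => [[order uniq_o /allP linked_o]|]; last by rewrite !andbF.
suff -> : b = c by rewrite !cat_uniq /= inE eqxx /= !andbF.
have o_b : linked order b by apply: linked_o; rewrite mem_cat !inE eqxx orbT.
have o_c : linked order c by apply: linked_o; rewrite mem_cat !inE eqxx !orbT.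
move: bB cB o_b o_c; rewrite !mem_arcs_at; case: b c {linked_o} => [b1 b2] [c1 c2] /=.
by move=> /andP[/eqP -> _] /andP[/eqP -> _] /(linked_inj_r uniq_o) inj /inj ->.
Qed.

Definition far (pre : seq (nat * nat)) p :=
  (d.*2 <= p)%N /\ {in pre, forall e, (e.1 < p) && (e.2 < p)}%N.

(* An empty stretch of length 2 d isolates the arcs of pre from the later ones,
   and lengthening it by one changes nothing. *)
Lemma extensions_far pre v p n : far pre p -> extensions pre v p.+1 n = extensions pre v p n.
Proof.
move=> [dp pre_p]; rewrite /extensions arcs_shift tuple_sum_map; apply: eq_tuple_sum_in => x _ xX.
congr (nat_of_bool _)%:R.
pose skip u := if (u < p)%N then u else u.+1.
pose unskip u := if (u < p)%N then u else u.-1.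
have skipK : cancel skip unskip.
  by move=> u; rewrite /skip /unskip; case: (ltnP u p) => [->|?] //; case: ltnP; lia.
have skip_inside u : (skip u \in iota d (p.+1 + n)) = (u \in iota d (p + n)).
  by rewrite !mem_iota /skip; case: (ltnP u p) => ?; lia.
pose skip_arc (e : nat * nat) := (skip e.1, skip e.2).
have skip_arc_inj : injective skip_arc.
  by move=> [a b] [a' b'] [] /(can_inj skipK) -> /(can_inj skipK) ->.
have -> : pre ++ [seq (e.1.+1, e.2.+1) | e <- x] = map skip_arc (pre ++ x).
  rewrite map_cat -{1}[pre]map_id; congr (_ ++ _); apply/eq_in_map => -[a b].
    by case/pre_p/andP => /= ap bp; rewrite /skip_arc /skip /= ap bp.
  move/xX; rewrite mem_arcs /skip_arc /skip /= => /and5P[? _ ? _ _].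
  by do 2 (case: ltnP; first lia); move=> *.
rewrite /forest_in map_inj_uniq // all_map; congr [&& _, _ & _].
  by apply: eq_all => -[a b] /=; rewrite !skip_inside.
by apply/asboolP/asboolP => ?; apply/(linear_forest_map _ skipK).
Qed.

Lemma far_cons pre p m e : far pre (p + m) -> e \in arcs_at d p ->
  (m <= d.*2)%N -> far (e :: pre) (p.+1 + d.*2).
Proof.
move=> [dp pre_pm]; case: e => u w; rewrite mem_arcs_at /= => /and4P[/eqP -> _ w_le _] md.
split=> [|e]; first lia.
rewrite inE => /orP[/eqP->|/pre_pm /andP[? ?]] /=; last by apply/andP; split; lia.
by apply/andP; split; move: w_le; clear; lia.
Qed.

Lemma extensions_degree_step v :
  (forall m pre p, (m <= d.*2)%N -> far pre (p + m) ->
     degree_lt_from (d.*2.+1 * v) v (increment pre v p)) ->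
  forall m pre p, (m <= d.*2)%N -> far pre (p + m) ->
    degree_lt_from (d.*2.+1 * v + m) v.+1 (extensions pre v p).
Proof.
move=> increment_degree; elim=> [|m IHm] pre p md far_pre.
  rewrite addn0; apply: degree_lt_from_fdiff => n Nn.
  rewrite -(increment_degree _ _ _ md far_pre n Nn); apply: eq_fdiffn => k.
  rewrite addn0 in far_pre.
  by rewrite /fdiff extensionsS extensions_far // addrC addKr.
rewrite addnS; apply: degree_lt_from_succ.
under eq_fun do rewrite extensionsS.
apply: degree_lt_fromD; first by apply: IHm; rewrite ?addSnnS // ltnW.
by apply: degree_lt_fromW (increment_degree _ _ _ md far_pre); rewrite ?leq_addr.
Qed.

Lemma extensions_degree v m pre p : (m <= d.*2)%N -> far pre (p + m) ->
  degree_lt_from (d.*2.+1 * v + m) v.+1 (extensions pre v p).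
Proof.
elim: v m pre p => [|v IHv]; apply: extensions_degree_step => // m pre p md far_pre.
rewrite /increment; under eq_fun do rewrite -mulr_natl.
apply: degree_lt_fromMl; apply: degree_lt_from_sum => e e_p.
by apply: degree_lt_fromW (IHv d.*2 _ _ _ (far_cons far_pre e_p md)); rewrite ?mulnS; lia.
Qed.

Definition forest_count v n : R :=
  tuple_sum (arcs d 0 n) v (fun x => (forest_in (iota d n) x)%:R).

End ForestCount.

Definition poly_start v d := (d.*2.+1 * v.+1)%N.

Lemma forest_count_degree (R : pzRingType) v d :
  degree_lt_from (poly_start v d) v.+1 (forest_count R d v).
Proof.
by apply: degree_lt_fromW (@extensions_degree R d v d.*2 [::] 0 _ _);
  rewrite // /poly_start mulnS; lia.
Qed.

(** * Permutations as words *)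

Section Words.
Local Open Scope nat_scope.
Variables d n : nat.

Definition word (s : 'S_n) : seq nat := [seq s i + d | i <- enum 'I_n].

Lemma size_word s : size (word s) = n.
Proof. by rewrite size_map size_enum_ord. Qed.

Lemma nth_word (s : 'S_n) (i : 'I_n) : nth 0 (word s) i = s i + d.
Proof. by rewrite (nth_map i) ?size_enum_ord // (nth_ord_enum i i). Qed.

Lemma word_inj : injective word.
Proof.
move=> s t st; apply/perm.permP => i; apply/val_inj/eqP.
by rewrite /= -(eqn_add2r d) -!nth_word st.
Qed.

Lemma perm_word_iota s : perm_eq (word s) (iota d n).
Proof.
have uniq_word : uniq (word s).
  rewrite map_inj_uniq ?enum_uniq // => i j /eqP; rewrite eqn_add2r => /eqP ij.
  exact/(perm_inj (s := s))/val_inj.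
apply: uniq_perm; rewrite ?iota_uniq //.
apply: (uniq_min_size uniq_word _ _).2; last by rewrite size_word size_iota.
by move=> _ /mapP[i _ ->]; rewrite mem_iota; have := ltn_ord (s i); lia.
Qed.

Lemma perm_words : perm_eq [seq word s | s <- enum 'S_n] (permutations (iota d n)).
Proof.
have uniq_words : uniq [seq word s | s <- enum 'S_n].
  by rewrite map_inj_uniq ?enum_uniq //; apply: word_inj.
apply: uniq_perm; rewrite ?permutations_uniq //.
apply: (uniq_min_size uniq_words _ _).2.
  by move=> _ /mapP[s _ ->]; rewrite mem_permutations perm_word_iota.
by rewrite size_map size_permutations ?iota_uniq // size_iota -cardE card_Sn.
Qed.

Lemma linked_word (s : 'S_n) (i j : 'I_n) : val j = (val i).+1 ->
  linked (word s) (s i + d, s j + d).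
Proof.
move=> ij; apply/linkedP; exists (take i (word s)), (drop j.+1 (word s)).
by rewrite -!nth_word -drop_nth ?size_word // ij -drop_nth ?size_word ?cat_take_drop.
Qed.

Lemma linked_wordP (s : 'S_n) u v : linked (word s) (u, v) ->
  exists i j : 'I_n, [/\ val j = (val i).+1, u = s i + d & v = s j + d].
Proof.
move=> /linkedP[s1 [s2 word_uv]].
have sizes : n = size s1 + (size s2).+2 by rewrite -(size_word s) word_uv size_cat.
have i_n : size s1 < n by lia.
have j_n : (size s1).+1 < n by lia.
exists (Ordinal i_n), (Ordinal j_n); rewrite -!nth_word word_uv /=.
by rewrite !nth_cat ltnn ltnNge leqnSn /= subnn subSnn.
Qed.

Lemma mj_ge_word (s : 'S_n) : mj_ge d.+1 s = ~~ has (linked (word s)) (arcs d 0 n).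
Proof.
apply/'forall_forallP/hasPn => [jumps [u v] uv_arc|no_arc i j].
  apply/negP => /linked_wordP[i [j [ij u_i v_j]]].
  have := jumps i j; rewrite ij eqxx /= /natdist.
  by move: uv_arc; rewrite u_i v_j mem_arcs /= => /and5P[_ _ ? ? _]; lia.
apply/implyP => /eqP ij; rewrite leqNgt; apply/negP => small_jump.
suff /no_arc : (s i + d, s j + d) \in arcs d 0 n by rewrite linked_word.
have s_ij : s i != s j :> nat.
  by apply/eqP => /val_inj/perm_inj ij'; move: ij; rewrite ij'; lia.
rewrite mem_arcs /=; move: small_jump s_ij (ltn_ord (s i)); rewrite /natdist; clear.
by move: (nat_of_ord (s i)) (nat_of_ord (s j)) => a b; lia.
Qed.

Lemma count_mj_geE : count_mj_ge n d.+1 =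
  count (fun s => ~~ has (linked s) (arcs d 0 n)) (permutations (iota d n)).
Proof.
rewrite -(seq.permP perm_words) count_map /count_mj_ge cardsE cardE /enum_mem size_filter.
by rewrite count_filter; apply: eq_count => s; rewrite /= andbT -mj_ge_word.
Qed.
End Words.

(** * Expansions in powers of 1/n *)

Section PolyGrowth.
Variable R : numDomainType.
Implicit Types c : nat -> R.

Definition poly_growth c := exists C m, forall d, `|c d| <= C * d.+1%:R ^+ m.

Lemma ler_succX (k m m' : nat) : (m <= m')%N -> k.+1%:R ^+ m <= k.+1%:R ^+ m' :> R.
Proof. by move=> mm; rewrite ler_weXn2l // ler1n. Qed.

Lemma poly_growth_nneg c : poly_growth c ->
  exists C m, 0 <= C /\ forall d, `|c d| <= C * d.+1%:R ^+ m.
Proof.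
move=> [C [m c_le]]; exists C, m; split=> //.
by have := le_trans (normr_ge0 _) (c_le 0%N); rewrite expr1n mulr1.
Qed.

Lemma poly_growth_le c c' : (forall d, `|c d| <= `|c' d|) -> poly_growth c' -> poly_growth c.
Proof. by move=> cc' [C [m c'_le]]; exists C, m => d; apply: le_trans (cc' d) (c'_le d). Qed.

Lemma eq_poly_growth c c' : c =1 c' -> poly_growth c -> poly_growth c'.
Proof. by move=> cc'; apply: poly_growth_le => d; rewrite cc'. Qed.

Lemma poly_growth_norm c : poly_growth c -> poly_growth (fun d => `|c d|).
Proof. by apply: poly_growth_le => d; rewrite normr_id. Qed.

Lemma poly_growthD c c' : poly_growth c -> poly_growth c' -> poly_growth (fun d => c d + c' d).
Proof.
move=> /poly_growth_nneg[C [m [C0 c_le]]] /poly_growth_nneg[C' [m' [C'0 c'_le]]].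
exists (C + C'), (m + m')%N => d; rewrite mulrDl; apply: le_trans (ler_normD _ _) _.
apply: lerD.
  by apply: le_trans (c_le d) _; rewrite ler_wpM2l // ler_succX ?leq_addr.
by apply: le_trans (c'_le d) _; rewrite ler_wpM2l // ler_succX ?leq_addl.
Qed.

Lemma poly_growthM c c' : poly_growth c -> poly_growth c' -> poly_growth (fun d => c d * c' d).
Proof.
move=> [C [m c_le]] [C' [m' c'_le]]; exists (C * C'), (m + m')%N => d.
by rewrite normrM exprD mulrACA ler_pM.
Qed.

Lemma poly_growth_const a : poly_growth (fun=> a).
Proof. by exists `|a|, 0%N => d; rewrite mulr1. Qed.

Lemma poly_growth_nat : poly_growth (fun d => d%:R).
Proof. by exists 1, 1%N => d; rewrite mul1r normr_nat ler_nat. Qed.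

Lemma poly_growthX c m : poly_growth c -> poly_growth (fun d => c d ^+ m).
Proof.
move=> c_growth; elim: m => [|m IH]; first exact: poly_growth_const.
by apply: eq_poly_growth (poly_growthM c_growth IH) => d; rewrite exprS.
Qed.

Lemma poly_growth_sum n (c : nat -> nat -> R) :
  (forall b, poly_growth (c b)) -> poly_growth (fun d => \sum_(b < n) c b d).
Proof.
move=> c_growth; elim: n => [|n IH].
  by apply: eq_poly_growth (poly_growth_const 0) => d; rewrite big_ord0.
by apply: eq_poly_growth (poly_growthD IH (c_growth n)) => d; rewrite big_ord_recr.
Qed.
End PolyGrowth.

Section IndexPolynomial.
Variable R : numDomainType.
Implicit Types f g : nat -> nat -> R.

(* Functions of (k, d) that are polynomial in k, with coefficients of polynomial growth in d. *)
Inductive index_poly : (nat -> nat -> R) -> Prop :=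
| index_poly_zero f : (forall k d, f k d = 0) -> index_poly f
| index_poly_step f :
    poly_growth (f 0%N) -> index_poly (fun k d => f k.+1 d - f k d) -> index_poly f.

Lemma eq_index_poly f g : (forall k d, f k d = g k d) -> index_poly f -> index_poly g.
Proof.
move=> + f_poly; elim: f_poly g => {f} [f f0|f f0 _ IH] g fg.
  by apply: index_poly_zero => k d; rewrite -fg.
apply: index_poly_step; first exact: eq_poly_growth (fg 0%N) f0.
by apply: IH => k d; rewrite !fg.
Qed.

Lemma index_polyD f g : index_poly f -> index_poly g -> index_poly (fun k d => f k d + g k d).
Proof.
move=> f_poly; elim: f_poly g => {f} [f f0|f f0 f_poly IH] g g_poly.
  by apply: eq_index_poly g_poly => k d; rewrite f0 add0r.
case: g_poly => {g} [g g0|g g0 g_poly].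
  by apply: (eq_index_poly (f := f)) (index_poly_step f0 f_poly) => k d; rewrite g0 addr0.
apply: index_poly_step; first exact: poly_growthD.
by apply: eq_index_poly (IH _ g_poly) => k d; rewrite opprD addrACA.
Qed.

Lemma index_polyM f g : index_poly f -> index_poly g -> index_poly (fun k d => f k d * g k d).
Proof.
move=> f_poly; elim: f_poly g => {f} [f f0|f f0 f_poly IHf] g g_poly.
  by apply: index_poly_zero => k d; rewrite f0 mul0r.
elim: g_poly => {g} [g g0|g g0 g_poly IHg].
  by apply: index_poly_zero => k d; rewrite g0 mulr0.
apply: index_poly_step; first exact: poly_growthM.
have := index_polyD (index_polyD (IHf g (index_poly_step g0 g_poly)) (IHf _ g_poly)) IHg.
by apply: eq_index_poly => k d; ring.
Qed.

Lemma index_poly_coef c : poly_growth c -> index_poly (fun _ d => c d).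
Proof.
by move=> c_growth; apply: index_poly_step => //; apply: index_poly_zero => k d; rewrite subrr.
Qed.

Lemma index_poly_const a : index_poly (fun _ _ => a).
Proof. exact/index_poly_coef/poly_growth_const. Qed.

Lemma index_poly_sum f : index_poly f -> index_poly (fun k d => \sum_(j < k) f j d).
Proof.
move=> f_poly; apply: index_poly_step.
  by apply: eq_poly_growth (poly_growth_const 0) => d; rewrite big_ord0.
by apply: eq_index_poly f_poly => k d; rewrite big_ord_recr /= [RHS]addrC addKr.
Qed.

Lemma index_poly_succ f : index_poly f -> index_poly (fun k d => f k.+1 d).
Proof.
case=> {f} [f f0|f f0 f_poly]; first by apply: index_poly_zero => k d.
by apply: eq_index_poly (index_polyD (index_poly_step f0 f_poly) f_poly) => k d;
  rewrite addrC subrK.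
Qed.

Lemma index_poly_bin b : index_poly (fun k _ => 'C(k, b)%:R).
Proof.
elim: b => [|b IH]; first by apply: eq_index_poly (index_poly_const 1) => k d; rewrite bin0.
by apply: eq_index_poly (index_poly_sum IH) => k d; rewrite -natr_sum sum_bin.
Qed.

Lemma index_poly_index : index_poly (fun k _ => k%:R).
Proof. by apply: eq_index_poly (index_poly_bin 1) => k d; rewrite bin1. Qed.

Lemma index_polyX f m : index_poly f -> index_poly (fun k d => f k d ^+ m).
Proof.
move=> f_poly; elim: m => [|m IH]; first exact: index_poly_const.
by apply: eq_index_poly (index_polyM f_poly IH) => k d; rewrite exprS.
Qed.

Lemma index_poly_newton f : index_poly f -> exists B (c : nat -> nat -> R),
  (forall b, poly_growth (c b)) /\ forall k d, f k d = \sum_(b < B) 'C(k, b)%:R * c b d.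
Proof.
elim => {f} [f f0|f f0 _ [B [c [c_growth f_newton]]]].
  exists 0%N, (fun _ _ => 0); split=> [b|k d]; first exact: poly_growth_const.
  by rewrite f0 big_ord0.
exists B.+1, (fun b d => if b is b'.+1 then c b' d else f 0%N d); split=> [[|b]|k d] //.
rewrite (sum_fdiff (f^~ d) k) big_ord_recl bin0 mul1r; congr (_ + _).
rewrite (eq_bigr _ (fun (j : 'I_k) _ => f_newton j d)) exchange_big; apply: eq_bigr => b _.
by rewrite lift0 -sum_bin natr_sum mulr_suml.
Qed.

Definition joint_power m k d : R := (k.+1 * d.+1)%:R ^+ m.

Lemma joint_power_ge0 m k d : 0 <= joint_power m k d.
Proof. by rewrite exprn_ge0. Qed.

Lemma ler_joint_power m m' k k' d : (m <= m')%N -> (k <= k')%N ->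
  joint_power m k d <= joint_power m' k' d.
Proof.
move=> mm kk; apply: (@le_trans _ _ (joint_power m' k d)); first exact: ler_succX.
by rewrite lerXn2r ?nnegrE // ler_nat leq_mul2r ltnS kk orbT.
Qed.

Lemma ler_sum_joint_power (f : nat -> R) C m k d :
  (forall j, (j < k)%N -> `|f j| <= C * joint_power m k d) ->
  0 <= C -> `|\sum_(j < k) f j| <= C * joint_power m.+1 k d.
Proof.
move=> f_le C0; apply: le_trans (ler_norm_sum _ _ _) _.
apply: le_trans (ler_sum _ (fun j _ => f_le _ (ltn_ord j))) _.
rewrite sumr_const card_ord -mulr_natl mulrCA ler_wpM2l //.
by rewrite /joint_power exprS ler_wpM2r ?exprn_ge0 // ler_nat; nia.
Qed.

Lemma index_poly_bound f : index_poly f ->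
  exists C m, 0 <= C /\ forall k d, `|f k d| <= C * joint_power m k d.
Proof.
elim => {f} [f f0|f /poly_growth_nneg[C0 [m0 [C0_ge0 f0_le]]] _ [C [m [C_ge0 diff_le]]]].
  by exists 0, 0%N; split=> // k d; rewrite f0 normr0 mul0r.
exists (C0 + C), (m0 + m.+1)%N; split=> [|k d]; first exact: addr_ge0.
rewrite (sum_fdiff (f^~ d) k) mulrDl; apply: le_trans (ler_normD _ _) _; apply: lerD.
  apply: le_trans (f0_le d) _; rewrite ler_wpM2l // -[d.+1]mul1n.
  by apply: (@ler_joint_power _ _ 0); rewrite ?leq_addr.
apply: (@le_trans _ _ (C * joint_power m.+1 k d)).
  apply: ler_sum_joint_power => // j jk; apply: le_trans (diff_le j d) _.
  by rewrite ler_wpM2l // ler_joint_power // ltnW.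
by rewrite ler_wpM2l // ler_joint_power ?leq_addl.
Qed.
End IndexPolynomial.

Section Expansion.
Variables (R : numFieldType) (A : nat).
Implicit Types f : nat -> nat -> nat -> R.

Definition admissible (k d n : nat) := [&& 0 < n, 0 < d, A * d.+1 <= n & k * k <= n]%N.

Lemma admissible_le k k' d n : (k <= k')%N -> admissible k' d n -> admissible k d n.
Proof. by move=> kk /and4P[n0 d0 An kn]; apply/and4P; split=> //; nia. Qed.

Lemma admissible_gt0 k d n : admissible k d n -> 0 < n%:R :> R.
Proof. by case/and4P => n0 _ _ _; rewrite ltr0n. Qed.

Lemma admissible_neq0 k d n : admissible k d n -> n%:R != 0 :> R.
Proof. by move/admissible_gt0/lt0r_neq0. Qed.

Lemma admissible_ge1 k d n : admissible k d n -> 1 <= n%:R :> R.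
Proof. by case/and4P => n0 _ _ _; rewrite ler1n. Qed.

Definition tame f := exists C m, 0 <= C /\
  forall k d n, admissible k d n -> `|f k d n| <= C * joint_power R m k d.

Lemma tame_le f g : (forall k d n, admissible k d n -> `|f k d n| <= `|g k d n|) ->
  tame g -> tame f.
Proof.
move=> fg [C [m [C0 g_le]]]; exists C, m; split=> // k d n adm.
exact: le_trans (fg _ _ _ adm) (g_le _ _ _ adm).
Qed.

Lemma eq_tame f g : (forall k d n, admissible k d n -> f k d n = g k d n) -> tame f -> tame g.
Proof. by move=> fg; apply: tame_le => k d n adm; rewrite fg. Qed.

Lemma tame_index_poly g : index_poly g -> tame (fun k d _ => g k d).
Proof. by move=> /index_poly_bound[C [m [C0 g_le]]]; exists C, m. Qed.

Lemma tameD f g : tame f -> tame g -> tame (fun k d n => f k d n + g k d n).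
Proof.
move=> [C [m [C0 f_le]]] [C' [m' [C'0 g_le]]]; exists (C + C'), (m + m')%N.
split=> [|k d n adm]; first exact: addr_ge0.
rewrite mulrDl; apply: le_trans (ler_normD _ _) _; apply: lerD.
  by apply: le_trans (f_le _ _ _ adm) _; rewrite ler_wpM2l // ler_joint_power ?leq_addr.
by apply: le_trans (g_le _ _ _ adm) _; rewrite ler_wpM2l // ler_joint_power ?leq_addl.
Qed.

Lemma tameM f g : tame f -> tame g -> tame (fun k d n => f k d n * g k d n).
Proof.
move=> [C [m [C0 f_le]]] [C' [m' [C'0 g_le]]]; exists (C * C'), (m + m')%N.
split=> [|k d n adm]; first exact: mulr_ge0.
by rewrite normrM /joint_power exprD mulrACA; apply: ler_pM => //; [apply: f_le|apply: g_le].
Qed.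

Lemma tame_divn f : tame f -> tame (fun k d n => f k d n / n%:R).
Proof.
apply: tame_le => k d n adm; rewrite normrM normfV normr_nat.
by rewrite ler_pdivrMr ?(admissible_gt0 adm) // ler_peMr ?(admissible_ge1 adm).
Qed.

Lemma tame_sum f : tame f -> tame (fun k d n => \sum_(j < k) f j.+1 d n).
Proof.
move=> [C [m [C0 f_le]]]; exists C, m.+1; split=> // k d n adm.
apply: (ler_sum_joint_power (f := fun j => f j.+1 d n)) => // j jk.
apply: le_trans (f_le _ _ _ (admissible_le jk adm)) _.
by rewrite ler_wpM2l // ler_joint_power.
Qed.

(* f has an expansion in powers of 1/n up to an error O(n^-t) on the admissible domain, with
   coefficients in [index_poly] and an error constant of polynomial growth in k and d. *)
Fixpoint expansion (t : nat) f : Prop :=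
  if t is t'.+1 then
    exists g f1, [/\ index_poly g, expansion t' f1 &
      forall k d n, admissible k d n -> f k d n = g k d + f1 k d n / n%:R]
  else tame f.

Lemma eq_expansion t f g : (forall k d n, admissible k d n -> f k d n = g k d n) ->
  expansion t f -> expansion t g.
Proof.
case: t => [|t] fg /=; first exact: eq_tame.
move=> [c [f1 [c_poly f1_exp fE]]]; exists c, f1; split=> // k d n adm.
by rewrite -fg // fE.
Qed.

Lemma expansion_tame_pow t f :
  tame (fun k d n => f k d n * n%:R ^+ t) -> expansion t f.
Proof.
elim: t f => [|t IH] f f_tame /=.
  by apply: eq_tame f_tame => k d n _; rewrite mulr1.
exists (fun _ _ => 0), (fun k d n => f k d n * n%:R); split; first exact: index_poly_const.
  by apply: IH; apply: eq_tame f_tame => k d n _; rewrite exprS mulrA.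
by move=> k d n adm; rewrite add0r mulfK ?(admissible_neq0 adm).
Qed.

Lemma expansion_index_poly t g : index_poly g -> expansion t (fun k d _ => g k d).
Proof.
case: t => [|t] g_poly; first exact: tame_index_poly.
exists g, (fun _ _ _ => 0); split=> // [|k d n _]; last by rewrite mul0r addr0.
apply: expansion_tame_pow; apply: eq_tame (tame_index_poly (index_poly_const 0)) => k d n _.
by rewrite mul0r.
Qed.

Lemma expansion_const t a : expansion t (fun _ _ _ => a).
Proof. exact/(expansion_index_poly t)/index_poly_const. Qed.

Lemma expansionD t f g : expansion t f -> expansion t g ->
  expansion t (fun k d n => f k d n + g k d n).
Proof.
elim: t f g => [|t IH] f g /=; first exact: tameD.
move=> [c [f1 [c_poly f1_exp fE]]] [c' [g1 [c'_poly g1_exp gE]]].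
exists (fun k d => c k d + c' k d), (fun k d n => f1 k d n + g1 k d n).
split; [exact: index_polyD|exact: IH|move=> k d n adm].
by rewrite fE // gE // mulrDl addrACA.
Qed.

Lemma expansion_pred t f : expansion t.+1 f -> expansion t f.
Proof.
elim: t f => [|t IH] f [c [f1 [c_poly f1_exp fE]]]; last by exists c, f1; split=> //; apply: IH.
apply: eq_tame (tameD (tame_index_poly c_poly) (tame_divn f1_exp)) => k d n adm.
by rewrite fE.
Qed.

Lemma expansion_tame t f : expansion t f -> tame f.
Proof. by elim: t => // t IH /expansion_pred. Qed.

Lemma expansion_divn t f : expansion t f -> expansion t (fun k d n => f k d n / n%:R).
Proof.
case: t => [|t] f_exp; first exact: tame_divn.
exists (fun _ _ => 0), f; split; [exact: index_poly_const|exact: expansion_pred|].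
by move=> k d n _; rewrite add0r.
Qed.

Lemma expansion_divnX t f m : expansion t f -> expansion t (fun k d n => f k d n / n%:R ^+ m).
Proof.
move=> f_exp; elim: m => [|m IH]; first by apply: eq_expansion f_exp => k d n _; rewrite divr1.
by apply: eq_expansion (expansion_divn IH) => k d n _; rewrite exprSr invfM mulrA.
Qed.

Lemma expansionM t f g : expansion t f -> expansion t g ->
  expansion t (fun k d n => f k d n * g k d n).
Proof.
elim: t f g => [|t IH] f g /=; first exact: tameM.
move=> [c [f1 [c_poly f1_exp fE]]] [c' [g1 [c'_poly g1_exp gE]]].
exists (fun k d => c k d * c' k d), (fun k d n =>
  c k d * g1 k d n + c' k d * f1 k d n + f1 k d n * g1 k d n / n%:R).
split=> [||k d n adm]; first exact: index_polyM.
  apply: expansionD; last by apply: expansion_divn; apply: IH.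
  by apply: expansionD; apply: IH => //; apply: expansion_index_poly.
by rewrite fE // gE //; field; apply: admissible_neq0 adm.
Qed.

Lemma expansionB t f g : expansion t f -> expansion t g ->
  expansion t (fun k d n => f k d n - g k d n).
Proof.
move=> f_exp g_exp; have := expansionD f_exp (expansionM (expansion_const t (-1)) g_exp).
by apply: eq_expansion => k d n _; rewrite mulN1r.
Qed.

Lemma expansion_bigsum t N (f : nat -> nat -> nat -> nat -> R) :
  (forall b, (b < N)%N -> expansion t (f b)) ->
  expansion t (fun k d n => \sum_(b < N) f b k d n).
Proof.
elim: N => [|N IH] f_exp.
  by apply: eq_expansion (expansion_const t 0) => k d n _; rewrite big_ord0.
have := expansionD (IH (fun b bN => f_exp b (ltnW bN))) (f_exp N (leqnn _)).
by apply: eq_expansion => k d n _; rewrite big_ord_recr.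
Qed.

Lemma expansion_index_sum t f : expansion t f ->
  expansion t (fun k d n => \sum_(j < k) f j.+1 d n).
Proof.
elim: t f => [|t IH] f /=; first exact: tame_sum.
move=> [c [f1 [c_poly f1_exp fE]]].
exists (fun k d => \sum_(j < k) c j.+1 d), (fun k d n => \sum_(j < k) f1 j.+1 d n).
split; [exact: index_poly_sum (index_poly_succ c_poly)|exact: IH|move=> k d n adm].
rewrite mulr_suml -big_split /=; apply: eq_bigr => j _; apply: fE.
exact: admissible_le (ltn_ord j) adm.
Qed.

Lemma expansion_fdiffn t f b v : (forall j, (j <= b + v)%N -> expansion t (fun _ => f j)) ->
  expansion t (fun _ d n => fdiffn b (fun k => f k d n) v).
Proof.
elim: b v => [|b IH] v f_exp; first exact: f_exp.
by apply: expansionB; apply: IH => j jb; apply: f_exp; lia.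
Qed.

Definition unit_expansion t f := exists2 f1, expansion t f1 &
  forall k d n, admissible k d n -> f k d n = 1 + f1 k d n / n%:R.

Lemma unit_expansion_succ t f : unit_expansion t f -> expansion t.+1 f.
Proof.
move=> [f1 f1_exp fE]; exists (fun _ _ => 1), f1; split=> //.
exact: index_poly_const.
Qed.

Lemma unit_expansionM t f g : unit_expansion t f -> unit_expansion t g ->
  unit_expansion t (fun k d n => f k d n * g k d n).
Proof.
move=> [f1 f1_exp fE] [g1 g1_exp gE].
exists (fun k d n => (f1 k d n + g1 k d n) + (f1 k d n * g1 k d n) / n%:R).
  exact: expansionD (expansionD f1_exp g1_exp) (expansion_divn (expansionM f1_exp g1_exp)).
by move=> k d n adm; rewrite fE // gE //; field; apply: admissible_neq0 adm.
Qed.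
End Expansion.

Section LeadingCoefficient.
Variables (R : archiNumFieldType) (A : nat).

Lemma tame_mulrn_eq0 (c : nat -> nat -> R) : tame A (fun k d n => c k d * n%:R) ->
  forall k d, (0 < d)%N -> c k d = 0.
Proof.
move=> [C [m [C0 c_le]]] k d d0; apply/eqP; rewrite -normr_eq0; apply: contraT => ckd_neq0.
pose B := C * joint_power R m k d / `|c k d|.
pose n := (A * d.+1 + k * k + Num.bound B).+1.
have adm : admissible A k d n by rewrite /n; apply/and4P; split=> //; lia.
have := c_le k d n adm; rewrite normrM normr_nat mulrC -ler_pdivlMr; last first.
  by rewrite lt0r ckd_neq0 normr_ge0.
rewrite -/B real_leNgt ?realn ?ger0_real ?mulr_ge0 ?invr_ge0 ?joint_power_ge0 //.
by rewrite (lt_le_trans (archi_boundP _)) ?mulr_ge0 ?invr_ge0 ?joint_power_ge0 ?ler_nat //; lia.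
Qed.

Lemma unit_expansion_tame t (f : nat -> nat -> nat -> R) : expansion A t.+1 f ->
  tame A (fun k d n => (f k d n - 1) * n%:R) -> unit_expansion A t f.
Proof.
move=> [c [f1 [c_poly f1_exp fE]]] f_tame; exists f1 => // k d n adm.
rewrite fE //; congr (_ + _); apply/eqP; rewrite -subr_eq0; apply/eqP.
apply: (tame_mulrn_eq0 (c := fun k d => c k d - 1)); last by case/and4P: adm.
apply: eq_tame (tameD f_tame (tameM (tame_index_poly A (index_poly_const (-1)))
  (expansion_tame f1_exp))) => k' d' n' adm'.
by rewrite fE //; field; apply: admissible_neq0 adm'.
Qed.
End LeadingCoefficient.

Section FallingRatio.
Variable R : realFieldType.

Definition falling_ratio n k : R := n%:R ^+ k * (n - k)`!%:R / n`!%:R.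

Lemma natr_fact_gt0 n : 0 < n`!%:R :> R.
Proof. by rewrite ltr0n fact_gt0. Qed.

Lemma falling_ratio_ge0 n k : 0 <= falling_ratio n k.
Proof. by rewrite !mulr_ge0 ?invr_ge0 ?exprn_ge0. Qed.

Lemma falling_ratio0 n : falling_ratio n 0 = 1.
Proof. by rewrite /falling_ratio subn0 mul1r divff // lt0r_neq0 ?natr_fact_gt0. Qed.

Lemma falling_ratioS n k : (k < n)%N ->
  falling_ratio n k.+1 * (n - k)%:R = n%:R * falling_ratio n k.
Proof. by move=> kn; rewrite /falling_ratio -(@subnSK k n) // factS natrM exprS; ring. Qed.

Lemma falling_ratio_recurrence n k : (k <= n)%N ->
  falling_ratio n k = 1 + (\sum_(j < k) j%:R * falling_ratio n j.+1) / n%:R.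
Proof.
elim: k => [|k IH] kn; first by rewrite big_ord0 mul0r addr0 falling_ratio0.
have n0 : n%:R != 0 :> R by rewrite pnatr_eq0; lia.
rewrite big_ord_recr mulrDl addrA -IH ?(ltnW kn) //=; apply: (mulfI n0).
rewrite mulrDr -(falling_ratioS kn) natrB ?(ltnW kn) //.
by field.
Qed.

Lemma falling_ratio_le n j k : (j <= k <= n)%N -> falling_ratio n j <= falling_ratio n k.
Proof.
case/andP; elim: k => [|k IH]; first by rewrite leqn0 => /eqP->.
rewrite leq_eqVlt => /predU1P[-> //|jk] kn; apply: le_trans (IH jk (ltnW kn)) _.
have nk_gt0 : 0 < (n - k)%:R :> R by rewrite ltr0n subn_gt0.
rewrite -(ler_pM2r nk_gt0) falling_ratioS // mulrC ler_wpM2r ?falling_ratio_ge0 //.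
by rewrite ler_nat leq_subr.
Qed.

(* By the recurrence the ratio r at k satisfies [r <= 1 + r * k (k - 1) / (2 n)]. *)
Lemma falling_ratio_le2 n k : (0 < n)%N -> (k * k <= n)%N -> falling_ratio n k <= 2.
Proof.
move=> n0 kk; have kn : (k <= n)%N by nia.
have n_gt0 : 0 < n%:R :> R by rewrite ltr0n.
suff : falling_ratio n k <= 1 + falling_ratio n k / 2 by lra.
rewrite {1}falling_ratio_recurrence // lerD2l ler_pdivrMr //.
apply: (@le_trans _ _ (\sum_(j < k) j%:R * falling_ratio n k)).
  by apply: ler_sum => j _; rewrite ler_wpM2l // falling_ratio_le // ltn_ord kn.
rewrite -mulr_suml -natr_sum [leLHS]mulrC -[leRHS]mulrA ler_wpM2l ?falling_ratio_ge0 //.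
rewrite [leRHS]mulrC ler_pdivlMr // -natrM ler_nat -(big_mkord predT id) bin2_sum.
by have := bin2 k; lia.
Qed.

Lemma falling_ratio_unit_expansion A t :
  unit_expansion A t (fun k _ n => falling_ratio n k).
Proof.
have of_expansion u : expansion A u (fun k _ n => falling_ratio n k) ->
  unit_expansion A u (fun k _ n => falling_ratio n k).
  move=> ratio_exp; exists (fun k _ n => \sum_(j < k) (j.+1%:R - 1) * falling_ratio n j.+1).
    apply: (expansion_index_sum (f := fun k _ n => (k%:R - 1) * falling_ratio n k)).
    apply: expansionM => //; apply: expansionB (expansion_const _ _ _).
    exact/expansion_index_poly/index_poly_index.
  move=> k d n /and4P[n0 _ _ kk]; rewrite falling_ratio_recurrence; last by nia.
  by congr (1 + _ / _); apply: eq_bigr => j _; rewrite -natr1 addrK.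
elim: t => [|t /unit_expansion_succ]; apply: of_expansion.
exists 2, 0%N; split=> // k d n /and4P[n0 _ _ kk].
by rewrite ger0_norm ?falling_ratio_ge0 // mulr1 falling_ratio_le2.
Qed.
End FallingRatio.

Section ForestDensity.
Variable R : realFieldType.

Lemma ler_norm_divrn (x : R) m : `|x / m%:R| <= `|x|.
Proof.
rewrite normrM normfV normr_nat ler_piMr //; case: m => [|m]; first by rewrite invr0.
by rewrite invf_le1 ?ltr0n ?ler1n.
Qed.

Definition forest_density k d n : R :=
  tuple_mean (arcs d 0 n) k (fun x => (forest_in (iota d n) x)%:R).

Lemma forest_densityE k d n : forest_density k d n = forest_count R d k n / (d.*2 * n)%:R ^+ k.
Proof. by rewrite /forest_density /tuple_mean size_arcs. Qed.

Lemma forest_count_bounds k d n : 0 <= forest_count R d k n <= (d.*2 * n)%:R ^+ k.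
Proof. by rewrite -(size_arcs d 0 n) tuple_sum_bool_bounds. Qed.

Lemma forest_density_bounds k d n : 0 <= forest_density k d n <= 1.
Proof.
rewrite forest_densityE; have /andP[count_ge0 count_le] := forest_count_bounds k d n.
rewrite mulr_ge0 ?invr_ge0 ?exprn_ge0 //=.
have [->|pow_neq0] := eqVneq ((d.*2 * n)%:R ^+ k : R) 0; first by rewrite invr0 mulr0.
by rewrite ler_pdivrMr ?mul1r // lt0r pow_neq0 exprn_ge0.
Qed.

Lemma forest_density0 d n : forest_density 0 d n = 1.
Proof. by rewrite /forest_density /tuple_mean /= forest_in_nil divr1. Qed.

Lemma ler_norm_fdiffn_forest_density d n u k : (0 < d)%N -> (0 < n)%N ->
  `|fdiffn u (fun k => forest_density k d n) k|
  <= 2 ^+ u.+1 * ((u + k)%:R ^+ 2 * (4 * d.+1%:R / n%:R)) ^+ uphalf u.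
Proof.
move=> d0 n0; have n_neq0 : n%:R != 0 :> R by rewrite pnatr_eq0 -lt0n.
have rare m : (m <= 4 * d.+1 * d.*2)%N ->
    m%:R <= 4 * d.+1%:R / n%:R * (size (arcs d 0 n))%:R :> R.
  move=> m_le; have -> : 4 * d.+1%:R / n%:R * (size (arcs d 0 n))%:R = (4 * d.+1 * d.*2)%:R :> R.
    by rewrite size_arcs !natrM; field.
  by rewrite ler_nat.
apply: (@ler_norm_fdiffn_tuple_mean _ _ (unusable (iota d n)) (@incident _)).
- by rewrite mulr_ge0 ?invr_ge0 ?mulr_ge0.
- by apply: rare; apply: leq_trans (count_unusable_arcs d n) _; nia.
- by move=> e; apply: rare; apply: leq_trans (count_incident_arcs d n e) _; nia.
- by rewrite -size_eq0 size_arcs; nia.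
- exact: insensitive_forest_in.
by move=> x; rewrite normr_nat lern1 leq_b1.
Qed.

Lemma forest_density_newton_tame A m : tame A (fun k d n =>
  (forest_density k d n
   - \sum_(b < m) 'C(k, b)%:R * fdiffn b (fun k => forest_density k d n) 0%N)
  * n%:R ^+ uphalf m).
Proof.
pose bound k d : R :=
  'C(k, m)%:R * (2 ^+ m.+1 * ((m%:R + k%:R) ^+ 2 * (4 * d.+1%:R)) ^+ uphalf m).
have bound_poly : index_poly bound.
  apply: index_polyM (index_poly_bin _ _) (index_polyM (index_poly_const _) (index_polyX _ _)).
  apply: index_polyM (index_polyX _ _) (index_poly_coef _).
    exact: index_polyD (index_poly_const _) (index_poly_index _).
  apply: poly_growthM (poly_growth_const _) _.
  by apply: eq_poly_growth (poly_growthD (poly_growth_nat _) (poly_growth_const 1)) => d;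
    rewrite natr1.
apply: tame_le (tame_index_poly A bound_poly) => k d n adm.
have n_gt0 := admissible_gt0 R adm; case/and4P: (adm) => n0 d0 _ _.
rewrite normrM normrX normr_nat -ler_pdivlMr ?exprn_gt0 //.
pose eps : R := 2 ^+ m.+1 * ((m + k)%:R ^+ 2 * (4 * d.+1%:R / n%:R)) ^+ uphalf m.
have <- : 'C(k, m)%:R * eps = `|bound k d| / n%:R ^+ uphalf m.
  rewrite ger0_norm; last by rewrite !mulr_ge0 ?exprn_ge0 ?mulr_ge0 ?exprn_ge0 ?addr_ge0.
  by rewrite /bound /eps natrD !mulrA [(_ / n%:R) ^+ _]exprMn exprVn !mulrA.
apply: (newton_remainder (f := fun k => forest_density k d n)) => j jk.
apply: le_trans (ler_norm_fdiffn_forest_density _ _ d0 n0) _.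
rewrite ler_wpM2l ?exprn_ge0 // lerXn2r ?nnegrE ?mulr_ge0 ?exprn_ge0 ?invr_ge0 ?mulr_ge0 //.
by rewrite ler_wpM2r ?mulr_ge0 ?invr_ge0 // lerXn2r ?nnegrE // ler_nat leq_add2l.
Qed.

Lemma poly_growth_poly_start v b : poly_growth (fun d => (poly_start v d + b)%:R : R).
Proof.
exists (3 * v.+1 + b)%:R, 1%N => d.
by rewrite normr_nat expr1 -natrM ler_nat /poly_start; nia.
Qed.

Lemma poly_start_le A v b k d n : (3 * v.+1 <= A)%N -> (b <= v.+1)%N -> admissible A k d n ->
  (poly_start v d + b <= n)%N.
Proof.
move=> Av bv /and4P[_ _ An _]; apply: leq_trans An.
apply: leq_trans (_ : 3 * v.+1 * d.+1 <= _)%N; last by rewrite leq_mul2r Av orbT.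
by rewrite /poly_start; nia.
Qed.

Lemma expansion_ffact_poly_start A t v b : (3 * v.+1 <= A)%N -> (b <= v.+1)%N ->
  expansion A t (fun _ d n => ((n - poly_start v d) ^_ b)%:R / n%:R ^+ b : R).
Proof.
move=> Av; elim: b => [|b IH] bv.
  by apply: eq_expansion (expansion_const A t 1) => k d n _; rewrite ffactn0 divr1.
have factor : expansion A t (fun _ d n => 1 - (poly_start v d + b)%:R / n%:R : R).
  apply: expansionB (expansion_const _ _ _) (expansion_divn _).
  exact: (expansion_index_poly A t (index_poly_coef (poly_growth_poly_start v b))).
apply: eq_expansion (expansionM (IH (ltnW bv)) factor) => k d n adm.
have n_neq0 := admissible_neq0 R adm.
rewrite ffactnSr natrM -subnDA natrB ?(poly_start_le Av (ltnW bv) adm) // exprSr.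
by field; rewrite n_neq0 expf_neq0.
Qed.

Definition forest_coef v b d : R :=
  fdiffn b (forest_count R d v) (poly_start v d) / (d.*2 ^ v * b`!)%:R.

Lemma poly_growth_forest_coef v b : poly_growth (forest_coef v b).
Proof.
apply: (@poly_growth_le _ _ (fun d => 2 ^+ b * (2 * d%:R * (poly_start v d + b)%:R) ^+ v)).
  move=> d; apply: le_trans (ler_norm_divrn _ _) _.
  rewrite [leRHS]ger0_norm; last by rewrite mulr_ge0 ?exprn_ge0 ?mulr_ge0.
  apply: ler_norm_fdiffn => j jb; have /andP[count_ge0 count_le] := forest_count_bounds v d j.
  rewrite ger0_norm //; apply: le_trans count_le _.
  by rewrite -!natrM mul2n lerXn2r ?nnegrE // ler_nat leq_mul2l jb orbT.
apply: poly_growthM (poly_growth_const _) (poly_growthX _ _).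
apply: poly_growthM (poly_growth_poly_start v b).
exact: poly_growthM (poly_growth_const _) (poly_growth_nat _).
Qed.

Lemma forest_density_newton A k d n v : (3 * v.+1 <= A)%N -> admissible A k d n ->
  forest_density v d n = \sum_(b < v.+1)
    forest_coef v b d * (((n - poly_start v d) ^_ b)%:R / n%:R ^+ b) / n%:R ^+ (v - b).
Proof.
move=> Av adm; have start_n := poly_start_le Av (leq0n _) adm; rewrite addn0 in start_n.
have n_neq0 := admissible_neq0 R adm.
have d_neq0 : d.*2%:R != 0 :> R by case/and4P: adm => _ d0 _ _; rewrite pnatr_eq0; lia.
rewrite forest_densityE (newton_exact (@forest_count_degree R v d) start_n) mulr_suml.
apply: eq_bigr => b _; rewrite natrM exprMn /forest_coef natrM natrX -bin_ffact.
have -> : n%:R ^+ v = n%:R ^+ b * n%:R ^+ (v - b) :> R by rewrite -exprD subnKC // -ltnS.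
have fact_neq0 : b`!%:R != 0 :> R by rewrite lt0r_neq0 ?natr_fact_gt0.
by rewrite natrM; field; rewrite fact_neq0 !expf_neq0.
Qed.

Lemma expansion_forest_density_at A t v : (3 * v.+1 <= A)%N ->
  expansion A t (fun _ d n => forest_density v d n).
Proof.
move=> Av; apply: eq_expansion => [k d n adm|]; first by rewrite (forest_density_newton Av adm).
apply: (expansion_bigsum (f := fun b _ d n =>
  forest_coef v b d * (((n - poly_start v d) ^_ b)%:R / n%:R ^+ b) / n%:R ^+ (v - b))) => b bv.
apply/expansion_divnX/expansionM; last by apply: expansion_ffact_poly_start; last apply: ltnW.
exact: (expansion_index_poly A t (index_poly_coef (poly_growth_forest_coef v b))).
Qed.

Lemma expansion_forest_density A t : (3 * t.*2.+1 <= A)%N ->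
  expansion A t (fun k d n => forest_density k d n).
Proof.
move=> At; pose newton k d n :=
  \sum_(b < t.*2) 'C(k, b)%:R * fdiffn b (fun k => forest_density k d n) 0%N.
apply: (eq_expansion (f := fun k d n => newton k d n + (forest_density k d n - newton k d n))).
  by move=> k d n _; rewrite addrC subrK.
apply: expansionD.
  apply: (expansion_bigsum (f := fun b k d n =>
    'C(k, b)%:R * fdiffn b (fun k => forest_density k d n) 0%N)) => b bt.
  apply: expansionM; first exact: (expansion_index_poly A t (index_poly_bin R b)).
  apply: expansion_fdiffn => j jb; apply: expansion_forest_density_at.
  by apply: leq_trans At; lia.
by apply: expansion_tame_pow; have := forest_density_newton_tame A t.*2; rewrite uphalf_double.
Qed.
End ForestDensity.

Lemma forest_density_unit_expansion (R : archiRealFieldType) A t : (3 * t.+1.*2.+1 <= A)%N ->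
  unit_expansion A t (fun k d n => forest_density R k d n).
Proof.
move=> At; apply: unit_expansion_tame; first exact: expansion_forest_density.
apply: eq_tame (forest_density_newton_tame R A 1) => k d n _.
by rewrite big_ord1 bin0 mul1r /fdiffn /= forest_density0.
Qed.

(** * Exponential sums *)

Import Rstruct Rstruct_topology reals normedtype sequences exp.

Section ExponentialSeries.
Variable R : realType.
Implicit Types x y : R.

Lemma exp_coeff_le_expR x n : 0 <= x -> exp_coeff x n <= expR x.
Proof.
move=> x0; apply: le_trans (expR_ge1Dxn n.-1 x0).
case: n => [|n]; last by rewrite lerDr.
by rewrite /exp_coeff /= expr0 divr1 lerDl mulr_ge0 ?invr_ge0.
Qed.

Lemma norm_exp_coeff x n : `|exp_coeff x n| = exp_coeff `|x| n.
Proof. by rewrite /exp_coeff /= normrM normfV normrX normr_nat. Qed.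

Lemma exp_coeffM a x n : exp_coeff (a * x) n = a ^+ n * exp_coeff x n.
Proof. by rewrite /exp_coeff /= exprMn mulrA. Qed.

Lemma exp_coeff_addn_le x J i : 0 <= x ->
  exp_coeff x (J + i) <= exp_coeff x i * exp_coeff x J.
Proof.
move=> x0; rewrite /exp_coeff /= exprD mulrACA -invfM [x ^+ i * _]mulrC.
rewrite ler_wpM2l ?mulr_ge0 ?exprn_ge0 // lef_pV2 ?posrE ?mulr_gt0 ?natr_fact_gt0 //.
by rewrite -natrM ler_nat -(bin_fact (leq_addl J i)) addnK leq_pmull // bin_gt0 leq_addl.
Qed.

Lemma series_exp_coeff_ge0 x n : 0 <= x -> 0 <= series (exp_coeff x) n.
Proof. by move=> x0; apply: sumr_ge0 => k _; apply: exp_coeff_ge0. Qed.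

Lemma series_exp_coeff_le x n : 0 <= x -> series (exp_coeff x) n <= expR x.
Proof.
move=> x0; apply: nondecreasing_cvgn_le; last exact: is_cvg_series_exp_coeff.
by apply: nondecreasing_series => k _ _; apply: exp_coeff_ge0.
Qed.

Lemma sum_exp_coeff_tail_le x J M : 0 <= x -> (J <= M)%N ->
  \sum_(J <= k < M) exp_coeff x k <= expR x * exp_coeff x J.
Proof.
move=> x0 JM; rewrite -{1}[J]add0n big_addn.
apply: le_trans (ler_wpM2r (exp_coeff_ge0 J x0) (series_exp_coeff_le (M - J)%N x0)).
by rewrite mulr_suml; apply: ler_sum => i _; rewrite addnC exp_coeff_addn_le.
Qed.

Lemma series_exp_coeffN_dist x J : 0 <= x ->
  `|series (exp_coeff (- x)) J - expR (- x)| <= expR x * exp_coeff x J.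
Proof.
move=> x0; set S := series _; have tail m : (J <= m)%N -> `|S m - S J| <= expR x * exp_coeff x J.
  move=> Jm; rewrite sub_series_geq //; apply: le_trans (ler_norm_sum _ _ _) _.
  under eq_bigr do rewrite norm_exp_coeff normrN (ger0_norm x0).
  exact: sum_exp_coeff_tail_le.
rewrite distrC ler_distl; apply/andP; split.
  apply: limr_ge; first exact: is_cvg_series_exp_coeff.
  by exists J => // m /= /tail; rewrite ler_distl => /andP[].
apply: limr_le; first exact: is_cvg_series_exp_coeff.
by exists J => // m /= /tail; rewrite ler_distl => /andP[].
Qed.

Lemma exp_coeff_decay x J : 0 <= x -> exp_coeff x J <= expR (expR 1 * x - J%:R).
Proof.
move=> x0; rewrite expRB ler_pdivlMr ?expR_gt0 // -[J%:R]mulr1 expRM_natl mulrC -exp_coeffM.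
by apply: exp_coeff_le_expR; rewrite mulr_ge0 ?expR_ge0.
Qed.

Lemma series_exp_coeffN_decay x J : 0 <= x ->
  `|series (exp_coeff (- x)) J - expR (- x)| <= expR ((1 + expR 1) * x - J%:R).
Proof.
move=> x0; apply: le_trans (series_exp_coeffN_dist J x0) _.
apply: le_trans (ler_wpM2l (expR_ge0 _) (exp_coeff_decay J x0)) _.
by rewrite -expRD mulrDl mul1r addrA.
Qed.

Lemma falling_ratio_le_expR n k : (k <= n)%N -> falling_ratio R n k <= expR k%:R.
Proof.
move=> kn; apply: le_trans (exp_coeff_le_expR k (ler0n R k)).
have ffact_le j : (j <= k)%N -> (n ^ j * k ^_ j <= k ^ j * n ^_ j)%N.
  elim: j => [|j IH] jk; first by rewrite !expn0 !ffactn0.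
  have step : (n * (k - j) <= k * (n - j))%N by nia.
  by rewrite !expnSr !ffactnSr [leqLHS]mulnACA [leqRHS]mulnACA leq_mul ?IH // ltnW.
rewrite /falling_ratio ler_pdivrMr ?natr_fact_gt0 // /exp_coeff /= mulrAC.
rewrite ler_pdivlMr ?natr_fact_gt0 // -!natrX -!natrM ler_nat -(ffact_fact kn) -[k`!]ffactnn.
by rewrite mulnAC mulnA leq_mul2r ffact_le ?orbT.
Qed.
End ExponentialSeries.

Section ExpSum.
Variable R : realType.
Implicit Types (x y : R) (f g : nat -> R).

Definition exp_sum y f K : R := \sum_(k < K) exp_coeff y k * f k.

Lemma eq_exp_sum y f g K : f =1 g -> exp_sum y f K = exp_sum y g K.
Proof. by move=> fg; apply: eq_bigr => k _; rewrite fg. Qed.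

Lemma exp_sum1 y K : exp_sum y (fun=> 1) K = series (exp_coeff y) K.
Proof. by rewrite seriesEord; apply: eq_bigr => k _; rewrite mulr1. Qed.

Lemma ler_norm_exp_sumN x f g K : 0 <= x -> (forall k, (k < K)%N -> `|f k| <= g k) ->
  `|exp_sum (- x) f K| <= exp_sum x g K.
Proof.
move=> x0 fg; apply: le_trans (ler_norm_sum _ _ _) _; apply: ler_sum => k _.
rewrite normrM norm_exp_coeff normrN (ger0_norm x0).
by apply: ler_wpM2l; rewrite ?exp_coeff_ge0 ?fg.
Qed.

Lemma exp_sum_bin y b K :
  exp_sum y (fun k => 'C(k, b)%:R) K = exp_coeff y b * series (exp_coeff y) (K - b)%N.
Proof.
rewrite /exp_sum; elim: K => [|K IH].
  by rewrite big_ord0 sub0n /series /= big_nil mulr0.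
rewrite big_ord_recr /= IH; have [Kb|bK] := ltnP K b.
  by rewrite bin_small // mulr0 addr0 (eqP (ltnW Kb)) (eqP Kb).
rewrite subSn // seriesSr mulrDr; congr (_ + _).
rewrite /exp_coeff /= mulrACA -exprD subnKC // -(bin_fact bK) !natrM.
have bin_neq0 : 'C(K, b)%:R != 0 :> R by rewrite pnatr_eq0 -lt0n bin_gt0.
by field; rewrite bin_neq0 !lt0r_neq0 ?natr_fact_gt0.
Qed.

Lemma exp_sum_newton y B (c : nat -> R) K :
  exp_sum y (fun k => \sum_(b < B) 'C(k, b)%:R * c b) K
  = \sum_(b < B) c b * (exp_coeff y b * series (exp_coeff y) (K - b)%N).
Proof.
rewrite /exp_sum; under eq_bigr do rewrite mulr_sumr.
rewrite exchange_big; apply: eq_bigr => b _; rewrite -exp_sum_bin mulr_sumr.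
by apply: eq_bigr => k _; rewrite [RHS]mulrC mulrA.
Qed.

Variable rate : nat -> R.
Hypothesis rate_ge0 : forall d, 0 <= rate d.
Hypothesis rate_growth : poly_growth rate.

Lemma poly_growth_exp_coeff b : poly_growth (fun d => exp_coeff (rate d) b).
Proof. exact: poly_growthM (poly_growthX _ rate_growth) (poly_growth_const _). Qed.

Lemma exp_sum_index_poly_le (g : nat -> nat -> R) : index_poly g -> exists2 P, poly_growth P &
  forall d K, exp_sum (rate d) (g^~ d) K <= P d * expR (rate d).
Proof.
move=> /index_poly_newton[B [c [c_growth gE]]].
exists (fun d => \sum_(b < B) `|c b d| * exp_coeff (rate d) b).
  apply: (@poly_growth_sum _ _ (fun b d => `|c b d| * exp_coeff (rate d) b)) => b.
  exact: poly_growthM (poly_growth_norm (c_growth b)) (poly_growth_exp_coeff b).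
move=> d K; rewrite (eq_exp_sum _ _ (gE^~ d)) (exp_sum_newton _ B (c^~ d)) mulr_suml.
apply: ler_sum => b _; rewrite -[leRHS]mulrA; apply: le_trans (ler_wpM2r _ (ler_norm _)) _.
  by rewrite mulr_ge0 ?exp_coeff_ge0 ?series_exp_coeff_ge0.
by rewrite !ler_wpM2l ?exp_coeff_ge0 ?series_exp_coeff_le.
Qed.

Lemma exp_sumN_index_poly (g : nat -> nat -> R) : index_poly g -> exists2 p, poly_growth p &
  exists2 P, poly_growth P & forall d K,
    `|exp_sum (- rate d) (g^~ d) K - p d * expR (- rate d)|
    <= P d * expR ((1 + expR 1) * rate d - K%:R).
Proof.
move=> /index_poly_newton[B [c [c_growth gE]]].
exists (fun d => \sum_(b < B) c b d * exp_coeff (- rate d) b).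
  apply: (@poly_growth_sum _ _ (fun b d => c b d * exp_coeff (- rate d) b)) => b.
  apply: poly_growthM (c_growth b) (poly_growth_le _ (poly_growth_exp_coeff b)) => d.
  by rewrite !norm_exp_coeff normrN.
exists (fun d => \sum_(b < B) `|c b d| * (exp_coeff (rate d) b * expR b%:R)).
  apply: (@poly_growth_sum _ _ (fun b d => `|c b d| * (exp_coeff (rate d) b * expR b%:R))) => b.
  apply: poly_growthM (poly_growth_norm (c_growth b)) _.
  exact: poly_growthM (poly_growth_exp_coeff b) (poly_growth_const _).
move=> d K; rewrite (eq_exp_sum _ _ (gE^~ d)) (exp_sum_newton _ B (c^~ d)) !mulr_suml.
rewrite -sumrB; apply: le_trans (ler_norm_sum _ _ _) _; apply: ler_sum => b _.
rewrite -[X in _ - X]mulrA -2!mulrBr 2!normrM norm_exp_coeff normrN (ger0_norm (rate_ge0 d)).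
rewrite -[leRHS]mulrA ler_wpM2l // -[leRHS]mulrA ler_wpM2l ?exp_coeff_ge0 //.
apply: le_trans (series_exp_coeffN_decay _ (rate_ge0 d)) _.
rewrite -expRD ler_expR.
have : K%:R <= (K - b)%:R + b%:R :> R by rewrite -natrD ler_nat; lia.
lra.
Qed.
End ExpSum.

(** * Asymptotics of the probability *)

Section JumpProbability.
Variable R : realType.

Definition jump_rate d : R := d.*2%:R.

Lemma jump_rate_ge0 d : 0 <= jump_rate d.
Proof. exact: ler0n. Qed.

Lemma poly_growth_jump_rate : poly_growth jump_rate.
Proof. by exists 2, 1%N => d; rewrite normr_nat -natrM ler_nat; lia. Qed.

Definition mj_prob n k : R := (count_mj_ge n k)%:R / n`!%:R.

Definition forest_weight k d n : R := falling_ratio R n k * forest_density R k d n.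

Lemma mj_probE n d : (0 < n)%N -> (0 < d)%N ->
  mj_prob n d.+1 = exp_sum (- jump_rate d) (fun k => forest_weight k d n) n.+1.
Proof.
move=> n0 d0; rewrite /mj_prob count_mj_geE.
rewrite (@count_avoiding R _ (iota d n)) ?iota_uniq ?arcs_uniq // size_iota mulr_suml.
apply: eq_bigr => k _; rewrite /forest_weight /falling_ratio forest_densityE natrM.
rewrite -/(forest_count R d k n) /exp_coeff /jump_rate /= [(- d.*2%:R) ^+ _]exprNn exprMn.
have pow_neq0 m : (0 < m)%N -> m%:R ^+ k != 0 :> R.
  by move=> m0; rewrite expf_neq0 // pnatr_eq0 -lt0n.
by field; rewrite !pow_neq0 ?double_gt0 // !lt0r_neq0 ?natr_fact_gt0.
Qed.

Lemma mj_prob1 n : mj_prob n 1 = 1.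
Proof.
rewrite /mj_prob count_mj_geE; have -> : arcs 0 0 n = [::] by apply: size0nil; rewrite size_arcs.
rewrite (eq_count (a2 := predT)) // count_predT size_permutations ?iota_uniq // size_iota.
by rewrite divff // lt0r_neq0 ?natr_fact_gt0.
Qed.

Lemma forest_weight_bounds k d n : (k <= n)%N -> 0 <= forest_weight k d n <= expR k%:R.
Proof.
move=> kn; have /andP[density_ge0 density_le1] := forest_density_bounds R k d n.
rewrite mulr_ge0 ?falling_ratio_ge0 //=.
by apply: le_trans (falling_ratio_le_expR R kn); rewrite ler_piMr ?falling_ratio_ge0.
Qed.

Lemma forest_weight_unit_expansion A t : (3 * t.+1.*2.+1 <= A)%N ->
  unit_expansion A t forest_weight.
Proof.
move=> At; exact: unit_expansionM (falling_ratio_unit_expansion R A t)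
  (forest_density_unit_expansion R At).
Qed.

Definition cutoff n := (Num.truncn (Num.sqrt n%:R : R)).+1.

Lemma cutoff_sqr k n : (k < cutoff n)%N -> (k * k <= n)%N.
Proof.
rewrite ltnS truncn_ge_nat ?sqrtr_ge0 // => k_le.
by rewrite -(ler_nat R) natrM -[n%:R]sqr_sqrtr // ler_pM.
Qed.

Lemma cutoff_le n : (cutoff n <= n.+1)%N.
Proof. by have := @cutoff_sqr (cutoff n).-1 n (leqnn _); rewrite /cutoff; nia. Qed.

(* The exponent is that of [expR x * expR (e * x - cutoff n)], the tail of the exponential series
   at [x = 2 d e], where the factor [e] accounts for [forest_weight k d n <= e ^ k]. *)
Definition tail d n : R := expR ((expR 1 + expR 1 ^+ 2) * jump_rate d - (cutoff n)%:R).

Lemma mj_prob_cutoff n d : (0 < n)%N -> (0 < d)%N ->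
  `|mj_prob n d.+1 - exp_sum (- jump_rate d) (fun k => forest_weight k d n) (cutoff n)|
  <= tail d n.
Proof.
move=> n0 d0; rewrite mj_probE // /exp_sum -!(big_mkord predT (fun k =>
  exp_coeff (- jump_rate d) k * forest_weight k d n)) (big_cat_nat (leq0n _) (cutoff_le n)) /=.
rewrite [X in `|X|]addrC addKr.
have e_rate_ge0 : 0 <= expR 1 * jump_rate d by rewrite mulr_ge0 ?expR_ge0 ?jump_rate_ge0.
apply: le_trans (ler_norm_sum _ _ _) _.
apply: (@le_trans _ _ (\sum_(cutoff n <= k < n.+1) exp_coeff (expR 1 * jump_rate d) k)).
  rewrite big_nat [leRHS]big_nat; apply: ler_sum => k /andP[_ kn].
  have /andP[weight_ge0 weight_le] := @forest_weight_bounds k d n kn.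
  rewrite exp_coeffM normrM norm_exp_coeff normrN !ger0_norm ?jump_rate_ge0 // mulrC.
  by rewrite ler_wpM2r ?exp_coeff_ge0 ?jump_rate_ge0 // -expRM_natl mulr1.
apply: le_trans (sum_exp_coeff_tail_le e_rate_ge0 (cutoff_le n)) _.
apply: le_trans (ler_wpM2l (expR_ge0 _) (exp_coeff_decay _ e_rate_ge0)) _.
by rewrite -expRD ler_expR; lra.
Qed.
End JumpProbability.

Section Regime.
Variables (R : realType) (A t : nat).
Implicit Types (err : nat -> nat -> R).

Local Notation jump_rate := (jump_rate R).
Local Notation tail := (tail R).

Definition regime d n := admissible A 0 d n && (tail d n <= (n%:R ^+ t)^-1).

Definition negligible s err := exists2 P, poly_growth P &
  forall d n, regime d n -> `|err d n| <= P d * expR (jump_rate d) / n%:R ^+ s.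

Lemma regime_ge1 d n : regime d n -> 1 <= n%:R :> R.
Proof. by case/andP => adm _; apply: admissible_ge1 adm. Qed.

Lemma regime_admissible k d n : (k < cutoff R n)%N -> regime d n -> admissible A k d n.
Proof. by move=> /cutoff_sqr kk /andP[/and4P[n0 d0 An _] _]; apply/and4P. Qed.

Lemma eq_negligible s err err' : (forall d n, regime d n -> err d n = err' d n) ->
  negligible s err -> negligible s err'.
Proof. by move=> ee' [P P_growth err_le]; exists P => // d n reg; rewrite -ee' ?err_le. Qed.

Lemma negligibleD s err err' : negligible s err -> negligible s err' ->
  negligible s (fun d n => err d n + err' d n).
Proof.
move=> [P P_growth err_le] [P' P'_growth err'_le].
exists (fun d => P d + P' d) => [|d n reg]; first exact: poly_growthD.
by rewrite !mulrDl; apply: le_trans (ler_normD _ _) _; rewrite lerD ?err_le ?err'_le.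
Qed.

Lemma negligible_divn s err : negligible s err -> negligible s.+1 (fun d n => err d n / n%:R).
Proof.
move=> [P P_growth err_le]; exists P => // d n reg.
by rewrite normrM normfV normr_nat exprSr invfM mulrA ler_wpM2r ?invr_ge0 ?err_le.
Qed.

Lemma negligible_tail s err P : (s <= t)%N -> poly_growth P ->
  (forall d n, regime d n -> `|err d n| <= P d * tail d n) -> negligible s err.
Proof.
move=> st P_growth err_le; exists (fun d => `|P d|) => [|d n reg]; first exact: poly_growth_norm.
have n1 := regime_ge1 reg; have n_gt0 := lt_le_trans ltr01 n1.
apply: le_trans (err_le d n reg) _; apply: le_trans (ler_wpM2r (expR_ge0 _) (ler_norm _)) _.
rewrite -[leRHS]mulrA ler_wpM2l //; case/andP: reg => _ tail_le; apply: le_trans tail_le _.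
apply: (@le_trans _ _ (n%:R ^+ s)^-1).
  by rewrite lef_pV2 ?posrE ?exprn_gt0 // ler_weXn2l.
by rewrite ler_peMl ?invr_ge0 ?exprn_ge0 // -expR0 ler_expR jump_rate_ge0.
Qed.

Definition signed_sum (f : nat -> nat -> nat -> R) d n :=
  exp_sum (- jump_rate d) (fun k => f k d n) (cutoff R n).

Lemma signed_sum_cons (g : nat -> nat -> R) f f1 d n :
  (forall k d n, admissible A k d n -> f k d n = g k d + f1 k d n / n%:R) -> regime d n ->
  signed_sum f d n
  = exp_sum (- jump_rate d) (g^~ d) (cutoff R n) + signed_sum f1 d n / n%:R.
Proof.
move=> fE reg; rewrite /signed_sum /exp_sum mulr_suml -big_split; apply: eq_bigr => k _ /=.
by rewrite (fE _ _ _ (regime_admissible (ltn_ord k) reg)) mulrDr mulrA.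
Qed.

Lemma signed_sum_tame f : tame A f -> negligible 0 (signed_sum f).
Proof.
move=> [C [m [C0 f_le]]].
have bound_poly : index_poly (fun k d => C * (k%:R + 1) ^+ m * (d%:R + 1) ^+ m : R).
  apply: index_polyM.
    apply: index_polyM (index_poly_const _) (index_polyX _ _).
    exact: index_polyD (index_poly_index _) (index_poly_const _).
  apply: index_poly_coef; apply: poly_growthX.
  exact: poly_growthD (poly_growth_nat _) (poly_growth_const _).
have [P P_growth sum_le] := exp_sum_index_poly_le (@jump_rate_ge0 R)
  (poly_growth_jump_rate R) bound_poly.
exists P => // d n reg; rewrite divr1; apply: le_trans (sum_le d (cutoff R n)).
apply: ler_norm_exp_sumN (jump_rate_ge0 R d) _ => k kK.
apply: le_trans (f_le _ _ _ (regime_admissible kK reg)) _.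
by rewrite /joint_power natrM exprMn -!natr1 mulrA.
Qed.

Lemma expR_le_tail d n : expR ((1 + expR 1) * jump_rate d - (cutoff R n)%:R) <= tail d n.
Proof.
rewrite ler_expR lerD2r ler_wpM2r ?jump_rate_ge0 // addrC lerD2l.
by rewrite exprn_ege1 ?ltW ?expR_gt1.
Qed.

Lemma exp_sum_index_poly_negligible (g : nat -> nat -> R) s : (s <= t)%N -> index_poly g ->
  exists2 p, poly_growth p & negligible s (fun d n =>
    exp_sum (- jump_rate d) (g^~ d) (cutoff R n) - p d * expR (- jump_rate d)).
Proof.
move=> st /(exp_sumN_index_poly (@jump_rate_ge0 R) (poly_growth_jump_rate R)).
move=> [p p_growth [P P_growth sum_le]]; exists p => //.
apply: (negligible_tail st (poly_growth_norm P_growth)) => d n _.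
apply: le_trans (sum_le d (cutoff R n)) _; apply: le_trans (ler_wpM2r (expR_ge0 _) (ler_norm _)) _.
by rewrite ler_wpM2l // expR_le_tail.
Qed.

Lemma exp_sum1_negligible s : (s <= t)%N -> negligible s (fun d n =>
  exp_sum (- jump_rate d) (fun=> 1) (cutoff R n) - expR (- jump_rate d)).
Proof.
move=> st; apply: (negligible_tail st (poly_growth_const 1)) => d n _.
rewrite exp_sum1 mul1r; apply: le_trans (expR_le_tail d n).
exact/series_exp_coeffN_decay/jump_rate_ge0.
Qed.

Lemma sum_inv_pow_recl s (c : nat -> R) n :
  \sum_(i < s.+1) c i / n%:R ^+ i = c 0%N + (\sum_(i < s) c i.+1 / n%:R ^+ i) / n%:R.
Proof.
rewrite big_ord_recl divr1 mulr_suml; congr (_ + _); apply: eq_bigr => i _.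
by rewrite lift0 exprSr invfM mulrA.
Qed.

Lemma signed_sum_expansion s f : (s <= t)%N -> expansion A s f ->
  exists2 p : nat -> nat -> R, (forall i, poly_growth (p i)) & negligible s (fun d n =>
    signed_sum f d n - (\sum_(i < s) p i d / n%:R ^+ i) * expR (- jump_rate d)).
Proof.
elim: s f => [|s IH] f st f_exp.
  exists (fun _ _ => 0) => [i|]; first exact: poly_growth_const.
  by apply: eq_negligible (signed_sum_tame f_exp) => d n _; rewrite big_ord0 mul0r subr0.
case: f_exp => g [f1 [g_poly f1_exp fE]].
have [p0 p0_growth g_sum] := exp_sum_index_poly_negligible st g_poly.
have [p p_growth f1_sum] := IH _ (ltnW st) f1_exp.
exists (fun i => if i is i'.+1 then p i' else p0) => [[|i] //|].
apply: eq_negligible (negligibleD g_sum (negligible_divn f1_sum)) => d n reg.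
pose coef i := (if i is i'.+1 then p i' else p0) d.
rewrite (signed_sum_cons fE reg) (sum_inv_pow_recl s coef) /coef /=.
by ring.
Qed.

Lemma mj_prob_expansion s : (s < t)%N -> (3 * s.+1.*2.+1 <= A)%N ->
  exists2 p : nat -> nat -> R, (forall i, poly_growth (p i)) & negligible s.+1 (fun d n =>
    mj_prob R n d.+1
    - (1 + (\sum_(i < s) p i d / n%:R ^+ i) / n%:R) * expR (- jump_rate d)).
Proof.
move=> st As; have [f1 f1_exp weightE] := forest_weight_unit_expansion R As.
have [p p_growth f1_sum] := signed_sum_expansion (ltnW st) f1_exp; exists p => //.
have cut : negligible s.+1 (fun d n => mj_prob R n d.+1 - signed_sum (forest_weight R) d n).
  apply: (negligible_tail st (poly_growth_const 1)) => d n /andP[/and4P[n0 d0 _ _] _].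
  by rewrite mul1r mj_prob_cutoff.
have := negligibleD cut (negligibleD (exp_sum1_negligible st) (negligible_divn f1_sum)).
apply: eq_negligible => d n reg.
by rewrite (signed_sum_cons (g := fun _ _ => 1) weightE reg); ring.
Qed.
End Regime.

Section EventualRegime.
Variable R : realType.

Lemma mul_ln_le_sqrt (L : R) : exists N, forall n, (N <= n)%N -> L * ln n%:R <= Num.sqrt n%:R.
Proof.
pose M := `|4 * L|; exists (Num.truncn (M ^+ 4)).+1 => n Mn.
have M4_le : M ^+ 4 <= n%:R.
  by apply: ltW; apply: lt_le_trans (truncnS_gt _) _; rewrite ler_nat.
have n_gt0 : 0 < n%:R :> R by rewrite ltr0n (leq_trans _ Mn).
set y := Num.sqrt (Num.sqrt n%:R : R).
have y_gt0 : 0 < y by rewrite !sqrtr_gt0.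
have yy : y ^+ 2 = Num.sqrt n%:R by rewrite sqr_sqrtr ?sqrtr_ge0.
have y4 : y ^+ 4 = n%:R by rewrite (exprM _ 2 2) yy sqr_sqrtr ?ltW.
have M_le : M <= y by rewrite -(@ler_pXn2r _ 4) ?nnegrE ?normr_ge0 ?(ltW y_gt0) ?y4.
have ln_le : ln n%:R <= 4 * y.
  by rewrite -y4 lnXn // -[leLHS]mulr_natl ler_wpM2l // ltW // ln_sublinear.
apply: (@le_trans _ _ (`|L| * (4 * y))).
  apply: le_trans (ler_wpM2l (normr_ge0 _) ln_le); rewrite ler_wpM2r ?ler_norm //.
  by rewrite ln_ge0 // ler1n -(ltr0n R).
by rewrite -yy mulrA expr2 ler_wpM2r ?(ltW y_gt0) // mulrC -[4]ger0_norm // -normrM.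
Qed.

Lemma eventually_regime A t (kappa : R) : exists N, forall n d, (N <= n)%N -> (0 < d)%N ->
  d%:R <= kappa * ln n%:R -> regime R A t d n.
Proof.
pose e : R := expR 1 + expR 1 ^+ 2.
have [N1 tail_small] := mul_ln_le_sqrt (e * (2 * kappa) + t%:R).
have [N2 d_small] := mul_ln_le_sqrt (A%:R * (2 * kappa)).
exists (maxn N1 N2).+1 => n d; rewrite gtn_max => /andP[N1n N2n] d0 d_le.
have n0 : (0 < n)%N by apply: leq_ltn_trans N1n.
have n_gt0 : 0 < n%:R :> R by rewrite ltr0n.
have double_le : 2 * d%:R <= 2 * kappa * ln n%:R by rewrite -mulrA ler_wpM2l.
rewrite /regime /admissible n0 d0 /= andbT; apply/andP; split.
  rewrite -(ler_nat R) natrM; apply: (@le_trans _ _ (Num.sqrt n%:R)).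
    apply: le_trans (d_small n (ltnW N2n)); rewrite -mulrA ler_wpM2l //.
    by apply: le_trans double_le; rewrite -natrM ler_nat; lia.
  by rewrite -[leRHS]sqr_sqrtr // expr2 ler_peMr ?sqrtr_ge0 // -[leLHS]sqrtr1 ler_sqrt ?ler1n.
have -> : (n%:R ^+ t)^-1 = expR (- (t%:R * ln n%:R)) :> R.
  by rewrite expRN expRM_natl lnK.
rewrite ler_expR lerBlDr [leRHS]addrC lerBrDr -/e.
apply: le_trans (ltW (truncnS_gt _)); apply: le_trans (tail_small n (ltnW N1n)).
rewrite [leRHS]mulrDl lerD2r -[leRHS]mulrA ler_wpM2l ?addr_ge0 ?exprn_ge0 ?expR_ge0 //.
by rewrite /jump_rate -mul2n natrM.
Qed.
End EventualRegime.

Section StandardReals.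
Local Open Scope R_scope.

(* [Num.truncn] vanishes on negative numbers, so the extension equals [p 0] left of [1]. *)
Definition extend (p : nat -> R) (x : R) : R := p (Num.truncn x).

Lemma extend_INR p d : extend p (INR d) = p d.
Proof. by rewrite /extend INRE natrK. Qed.

Lemma extend_poly_bounded p : poly_growth p -> poly_bounded (extend p).
Proof.
move=> /poly_growth_nneg[C [m [C0 p_le]]]; exists C, m => x; apply/RleP.
rewrite RabsE RmultE RpowE RplusE RabsE; apply: le_trans (p_le _) _.
rewrite ler_wpM2l // lerXn2r ?nnegrE ?addr_ge0 // -natr1 addrC lerD2l.
have [x0|x0] := leP 0%R x; last by rewrite truncn_floor (lt_geF x0) normr_ge0.
by apply: le_trans (ler_norm x); have /andP[] := truncn_itv x0.
Qed.

Lemma fold_right_seqE (f : nat -> R) a s :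
  List.fold_right (fun i acc => Rplus (f i) acc) 0 (List.seq a s) = \sum_(i < s) f (a + i)%N.
Proof.
elim: s a => [|s IH] a; first by rewrite big_ord0.
rewrite /= IH big_ord_recl addn0 RplusE; congr (_ + _)%R; apply: eq_bigr => i _.
by rewrite lift0 addnS.
Qed.

Lemma corr_sumE s (p : nat -> nat -> R) d n :
  corr_sum s.+1 (fun i => extend (p i)) (INR d) n
  = ((\sum_(i < s) p i.+1 d / n%:R ^+ i) / n%:R)%R.
Proof.
rewrite /corr_sum subn1 /= fold_right_seqE mulr_suml; apply: eq_bigr => i _.
by rewrite extend_INR RdivE RpowE INRE add1n exprSr invfM mulrA.
Qed.

Lemma prob_mj_geE n k : prob_mj_ge n k = mj_prob R n k.
Proof. by rewrite /prob_mj_ge RdivE !INRE. Qed.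

Lemma exp_jump_rate d : exp (2 * INR d) = expR (jump_rate R d).
Proof. by rewrite RexpE RmultE IZRposE !INRE -natrM mul2n. Qed.

Lemma exp_opp_jump_rate d : exp (- 2 * INR d) = expR (- jump_rate R d)%R.
Proof. by rewrite RexpE RmultE (opp_IZR 2) RoppE IZRposE !INRE mulNr -natrM mul2n. Qed.

Lemma big_O_log_ln d : big_O_log d ->
  exists (kappa : R) N, forall n, (N <= n)%N -> ((d n)%:R <= kappa * ln n%:R)%R.
Proof.
move=> [kappa [N d_le]]; exists kappa, N => n /ssrnat.leP/d_le/RleP.
by rewrite RmultE !INRE RlnE.
Qed.

Lemma prob_mj_ge_asymptotics (s : nat) :
  exists2 p : nat -> nat -> R, (forall i, poly_growth (p i)) &
  exists2 P : nat -> R, poly_growth P & forall d : nat -> nat, big_O_log d ->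
    exists N, forall n, (N <= n)%coq_nat ->
      Rabs (prob_mj_ge n (d n).+1
            - (1 + corr_sum s.+1 (fun i => extend (p i)) (INR (d n)) n) * exp (- 2 * INR (d n)))
      <= Rabs (P (d n)) * exp (2 * INR (d n)) / INR n ^ s.+1.
Proof.
have [p p_growth [P P_growth prob_le]] :=
  @mj_prob_expansion R (3 * s.+1.*2.+1) s.+1 s (leqnn _) (leqnn _).
(* For d = 0 the probability is 1 and all the corrections vanish. *)
pose p' i d : R := if d is 0%N then 0%R else p i.-1 d.
exists p' => [i|].
  by apply: poly_growth_le (p_growth i.-1) => -[|d] //=; rewrite normr0.
exists P => // d /big_O_log_ln[kappa [N1 d_le]].
have [N2 regime_n] := eventually_regime (3 * s.+1.*2.+1) s.+1 kappa.
exists (maxn N1 N2) => n /ssrnat.leP; rewrite geq_max => /andP[N1n N2n]; apply/RleP.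
rewrite exp_jump_rate exp_opp_jump_rate prob_mj_geE corr_sumE.
rewrite !(RabsE, RmultE, RminusE, RplusE, RdivE, RpowE, INRE).
have := d_le n N1n; case: (d n) => [|d'] d'_le.
  rewrite mj_prob1 big1 => [|i _]; last by rewrite mul0r.
  rewrite mul0r addr0 mul1r /jump_rate oppr0 expR0 subrr normr0.
  by rewrite !mulr_ge0 ?invr_ge0 ?exprn_ge0 ?normr_ge0 ?expR_ge0.
apply: le_trans (prob_le d'.+1 n (regime_n n d'.+1 N2n isT d'_le)) _.
by rewrite !ler_wpM2r ?invr_ge0 ?exprn_ge0 ?expR_ge0 ?ler_norm.
Qed.
End StandardReals.

End MinimumJump.

Import ssreflect.
Open Scope R_scope.

Theorem theorem2 (t : nat) (ht : (1 <= t)%nat) :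
  exists (p : nat -> R -> R) (q : R -> R),
    (forall i : nat, (1 <= i <= t - 1)%nat -> poly_bounded (p i)) /\
    poly_bounded q /\
    forall d : nat -> nat, big_O_log d ->
      exists (C : R) (N : nat), forall n : nat, (N <= n)%nat ->
        Rabs (prob_mj_ge n (d n + 1)
              - (1 + corr_sum t p (INR (d n)) n) * exp (- 2 * INR (d n)))
        <= C * (Rabs (q (INR (d n))) * exp (2 * INR (d n)) / INR n ^ t).
Proof.
case: t ht => [/Nat.nle_succ_0 //|s _].
have [p p_growth [P P_growth prob_le]] := MinimumJump.prob_mj_ge_asymptotics s.
exists (fun i => MinimumJump.extend (p i)), (MinimumJump.extend P); split; [|split].
- by move=> i _; apply: MinimumJump.extend_poly_bounded.
- exact: MinimumJump.extend_poly_bounded.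
- move=> d /prob_le[N prob_le_N]; exists 1, N => n /prob_le_N.
  by rewrite MinimumJump.extend_INR Rmult_1_l Nat.add_1_r.
Qed.
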